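(* Let $\mathcal A\subset\mathrm{CDD}_N$ be an ideal. For every $T\in\mathrm{CDD}_N$ there is a unique $E\in\mathrm{red}(T)$ such that $$T|_E\in\mathcal A\qquad\text{and}\qquad T|_{E^{\perp}}\in\mathcal A^{\perp}.$$ Moreover, $E\in\mathrm{cred}(T)$ and $$E=\bigvee\{K\in\mathrm{red}(T):\ T|_K\in\mathcal A\}.$$
   Context: $N\ge 1$ is a fixed integer. Hilbert spaces are complex and of arbitrary dimension (possibly $0$, possibly uncountable). $\mathrm{CDD}_N(H)$ is the set of all $N$-tuples $A=(A_1,\dots,A_N)$ of closed densely defined linear operators in $H$; $\mathrm{CDD}_N=\bigcup_H\mathrm{CDD}_N(H)$, where $H$ runs over all Hilbert spaces. A tuple is trivial if it acts on the zero-dimensional space. For a closed subspace $E\subset H$ with orthogonal projection $P_E$, $E\in\mathrm{red}(A)$ (reducing subspace) means $P_EA_j\subset A_jP_E$ for $j=1,\dots,N$; then $A|_E=(A_1|_E,\dots,A_N|_E)$, where $A_j|_E$ is the restriction of $A_j$ to $D(A_j)\cap E$, regarded as an operator in $E$. $\mathrm{cred}(A)$ is the set of those $E\in\mathrm{red}(A)$ for which $P_EP_K=P_KP_E$ for all $K\in\mathrm{red}(A)$. $\bigvee$ of a family of closed subspaces is the smallest closed subspace containing them all; $E^\perp$ is the orthogonal complement. Direct sums $\bigoplus_sA^{(s)}$ of tuples are coordinatewise; the direct sum $\bigoplus_sT_s$ of operators acts in the Hilbert space direct sum, with domain $\{\oplus_sx_s:\ x_s\in D(T_s),\ \sum_s\|T_sx_s\|^2<\infty\}$.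 $A\equiv B$ (unitary equivalence) means that there is a unitary $U$ from the space of $A$ onto that of $B$ with $A_j=U^{-1}B_jU$ for all $j$. $A\le B$ means $A\equiv B|_E$ for some $E\in\mathrm{red}(B)$. $A\perp_uB$ (unitarily disjoint) means that there is no nontrivial $X\in\mathrm{CDD}_N$ with $X\le A$ and $X\le B$. A subclass $\mathcal A\subset\mathrm{CDD}_N$ is an ideal if it is nonempty; $A\in\mathcal A$ and $A\equiv B\in\mathrm{CDD}_N$ imply $B\in\mathcal A$; $A\in\mathcal A$ and $E\in\mathrm{red}(A)$ imply $A|_E\in\mathcal A$; and $\bigoplus_{s\in S}A_s\in\mathcal A$ for every nonempty family (indexed by a set) $\{A_s\}_{s\in S}\subset\mathcal A$. For a subclass $\mathcal F\subset\mathrm{CDD}_N$, $\mathcal F^\perp=\{T\in\mathrm{CDD}_N:\ T\perp_uF\text{ for every }F\in\mathcal F\}$. *)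

(* Defs.v *)
From HB Require Import structures.
From mathcomp Require Import all_boot all_order all_algebra.
From mathcomp Require Import complex sesquilinear finmap.
From mathcomp Require Import boolp classical_sets functions cardinality fsbigop.
From mathcomp Require Import reals ereal.
From mathcomp Require Import topology normedtype sequences esum.
From mathcomp.analysis Require Import showcase.summability.
From mathcomp Require Import ring lra.

Set Implicit Arguments.
Unset Strict Implicit.
Unset Printing Implicit Defensive.

Import Order.TTheory GRing.Theory Num.Theory.
Import numFieldNormedType.Exports.

Local Open Scope classical_set_scope.
Local Open Scope ring_scope.

(* The norm of a normedModType over R[i] takes its values in R[i]; the inner
   product is linear in its first argument and conjugate-linear in the second. *)
HB.mixin Record isHilbert (R : realType) V & CompleteNormedModule R[i] V := {
  inner : {dot V for Num.conj};
  inner_norm : forall x : V, `|x| ^+ 2 = inner x x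
}.

#[short(type="hilbertType")]
HB.structure Definition Hilbert (R : realType) :=
  {V of CompleteNormedModule R[i] V & isHilbert R V}.

Section dot.
Context {R : realType} {V : lmodType R[i]} (f : {dot V for Num.conj}).

(* f x x is a nonnegative real, see dot_sqnorm: sqnorm is the squared norm as an
   element of R. *)
Definition sqnorm (x : V) : R := complex.Re (f x x).

Definition dotnorm (x : V) : R[i] := (Num.sqrt (sqnorm x))%:C%C.

Lemma dot_sqnorm x : f x x = (sqnorm x)%:C%C.
Proof.
have := dnorm_ge0 f x; rewrite /sqnorm; case: (f x x) => a b /=.
by rewrite lecE /= => /andP[/eqP -> _].
Qed.

Lemma sqnorm_ge0 x : 0 <= sqnorm x.
Proof. by rewrite -ler0c -dot_sqnorm dnorm_ge0. Qed.

Lemma sqnorm_eq0 x : sqnorm x = 0 -> x = 0.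
Proof. by move=> x0; apply/eqP; rewrite -(dnorm_eq0 f) dot_sqnorm x0. Qed.

Lemma sqnormZ a x : (sqnorm (a *: x))%:C%C = `|a| ^+ 2 * (sqnorm x)%:C%C.
Proof. by rewrite -!dot_sqnorm dnormZ. Qed.

Lemma sqnormD x y :
  sqnorm (x + y) = sqnorm x + sqnorm y + 2 * complex.Re (f x y).
Proof.
rewrite /sqnorm dnormD !raddfD/=; congr (_ + _).
by case: (f x y) => a b /=; rewrite mulr2n mulrDl mul1r.
Qed.

Lemma dot_cauchy_schwarz x y : complex.Re (f x y) ^+ 2 <= sqnorm x * sqnorm y.
Proof.
have [->|y0] := eqVneq y 0; 
  first by rewrite linear0r /sqnorm linear0r /= mulr0 expr0n.
have y_gt0 : 0 < sqnorm y.
  by have := y0; rewrite -(dnorm_gt0 f) dot_sqnorm ltcE => /andP[].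
set a := sqnorm y; set b := complex.Re (f x y).
have := sqnorm_ge0 (a%:C%C *: x + (- b)%:C%C *: y).
rewrite sqnormD.
have -> : sqnorm (a%:C%C *: x) = a ^+ 2 * sqnorm x.
  by apply: complexI; rewrite sqnormZ normc_def/= expr0n addr0 sqrtr_sqr rmorphM
    rmorphXn/= -!rmorphXn/= real_normK ?num_real.
have -> : sqnorm ((- b)%:C%C *: y) = b ^+ 2 * a.
  by apply: complexI; rewrite sqnormZ normc_def/= expr0n addr0 sqrtr_sqr rmorphM
    rmorphXn/= -!rmorphXn/= real_normK ?num_real// sqrrN.
have -> : complex.Re (f (a%:C%C *: x) ((- b)%:C%C *: y)) = - (a * b * b).
  rewrite linearZlr/= /b; case: (f x y) => u v /=; ring.
rewrite -/a => h; rewrite -(ler_pM2l y_gt0) -/a -/b; lra.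
Qed.
End dot.

(* A left R[i]-module with an inner product whose Cauchy filters (for the
   induced norm) converge is a Hilbert space. *)
HB.factory Record Lmodule_isHilbert (R : realType) V & GRing.Lmodule R[i] V := {
  dotp : {dot V for Num.conj};
  dotp_complete : forall F : set_system V, ProperFilter F ->
    (forall e : R, 0 < e -> exists x, F [set y | sqnorm dotp (x - y) < e]) ->
    exists l, forall e : R, 0 < e -> F [set y | sqnorm dotp (l - y) < e]
}.

HB.builders Context R V & Lmodule_isHilbert R V.

Lemma dotnormD x y : dotnorm dotp (x + y) <= dotnorm dotp x + dotnorm dotp y.
Proof.
rewrite /dotnorm -rmorphD lecR -(@ler_pXn2r _ 2) ?nnegrE ?addr_ge0 ?sqrtr_ge0//.
rewrite sqr_sqrtr ?sqnorm_ge0// sqrrD !sqr_sqrtr ?sqnorm_ge0// sqnormD.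
rewrite [leRHS]addrAC lerD2l -[leRHS]mulr_natl ler_pM2l// -sqrtrM ?sqnorm_ge0//.
apply: le_trans (ler_norm _) _; rewrite -sqrtr_sqr ler_wsqrtr//.
exact: dot_cauchy_schwarz.
Qed.

Lemma dotnormZ (a : R[i]) x : dotnorm dotp (a *: x) = `|a| * dotnorm dotp x.
Proof.
rewrite /dotnorm normc_def -rmorphM -sqrtrM ?addr_ge0 ?sqr_ge0//.
congr (Num.sqrt _)%:C%C.
apply: complexI; rewrite sqnormZ normc_def -rmorphXn sqr_sqrtr;
  last by rewrite addr_ge0 ?sqr_ge0.
by rewrite rmorphM.
Qed.

Lemma dotnorm_eq0 x : dotnorm dotp x = 0 -> x = 0.
Proof.
move=> [] /eqP; rewrite sqrtr_eq0 => x0; apply: (@sqnorm_eq0 _ _ dotp).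
by apply/eqP; rewrite eq_le x0 sqnorm_ge0.
Qed.

HB.instance Definition _ := Lmodule_isNormed.Build R[i] V
  dotnormD dotnormZ dotnorm_eq0.

Lemma normE x : `|x| = dotnorm dotp x. Proof. by []. Qed.

Lemma norm_lt (e : R[i]) x : 0 < e ->
  (`|x| < e) = (sqnorm dotp x < complex.Re e ^+ 2).
Proof.
case: e => e1 e2; rewrite ltcE /= => /andP[/eqP -> e1_gt0].
rewrite normE /dotnorm ltcE/= eqxx/= -(@ltr_pXn2r _ 2) ?nnegrE ?sqrtr_ge0
  ?ltW//.
by rewrite sqr_sqrtr// sqnorm_ge0.
Qed.

Lemma complete_subproof (F : set_system V) :
  ProperFilter F -> cauchy F -> cvg F.
Proof.
move=> FF /cauchyP F_cauchy.
have [|l Fl] := dotp_complete FF.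
  move=> e e0.
  have e0' : 0 < (Num.sqrt e)%:C%C by rewrite ltcE/= eqxx sqrtr_gt0.
  have [x Fx] := F_cauchy _ e0'; exists x; apply: filterS Fx => y.
  by rewrite -ball_normE/= norm_lt//= sqr_sqrtr// ltW.
apply/cvg_ex; exists l; apply/fcvgrPdist_lt => e e0.
have e1 : 0 < complex.Re e ^+ 2.
  by move: e0; case: (e) => a b; rewrite ltcE/= => /andP[_ /exprn_gt0].
by apply: filterS (Fl _ e1) => y; rewrite /= norm_lt.
Qed.

HB.instance Definition _ := Uniform_isComplete.Build V complete_subproof.

Lemma inner_norm_subproof (x : V) : `|x| ^+ 2 = dotp x x.
Proof.
by rewrite normE /dotnorm -rmorphXn sqr_sqrtr ?sqnorm_ge0// dot_sqnorm.
Qed.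

HB.instance Definition _ := isHilbert.Build R V inner_norm_subproof.

HB.end.

Section hilbert_theory.
Context {R : realType} {H : hilbertType R}.
Implicit Types x y : H.

Lemma sqnorm_norm x : (sqnorm inner x)%:C%C = `|x| ^+ 2.
Proof. by rewrite inner_norm dot_sqnorm. Qed.

Lemma hnorm_lt (e : R) x : 0 < e -> (`|x| < e%:C%C) = (sqnorm inner x < e ^+ 2).
Proof.
move=> e0; have e0' : 0 < e%:C%C :> R[i] by rewrite ltcE /= eqxx.
rewrite -(@ltr_pXn2r _ 2) ?nnegrE ?normr_ge0 ?ltW// inner_norm dot_sqnorm.
by rewrite -rmorphXn ltcE/= eqxx.
Qed.

Lemma sqnorm_cauchy_cvg (F : set_system H) : ProperFilter F ->
  (forall e : R, 0 < e -> exists x, F [set y | sqnorm inner (x - y) < e]) ->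
  cvg F.
Proof.
move=> FF Fc; apply: cauchy_cvg; apply: cauchy_exP => e e0.
have e1 : 0 < complex.Re e by move: e0; rewrite ltcE => /andP[].
have eE : e = (complex.Re e)%:C%C.
  by move: e0; case: (e) => a b; rewrite ltcE /= => /andP[/eqP ->].
have [x Fx] := Fc (complex.Re e ^+ 2) (exprn_gt0 _ e1); exists x.
by apply: filterS Fx => y /=; rewrite -ball_normE/= eE hnorm_lt.
Qed.

Lemma cvg_sqnorm (F : set_system H) l : Filter F -> F --> l ->
  forall e : R, 0 < e -> F [set y | sqnorm inner (l - y) < e].
Proof.
move=> FF /fcvgrPdist_lt Fl e e0.
have e1 : 0 < Num.sqrt e by rewrite sqrtr_gt0.
have e2 : 0 < (Num.sqrt e)%:C%C :> R[i] by rewrite ltcE /= eqxx.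
by apply: filterS (Fl _ e2) => y /=; rewrite hnorm_lt// sqr_sqrtr// ltW.
Qed.

End hilbert_theory.

Record closed_subspace (R : realType) (H : hilbertType R) := ClosedSubspace {
  cs_set :> set H;
  cs_linear : cs_set 0 /\
    forall (a : R[i]) x y, cs_set x -> cs_set y -> cs_set (a *: x + y);
  cs_closed : closed cs_set
}.

Definition cs_mem (R : realType) (H : hilbertType R) (E : closed_subspace H) :
    {pred H} :=
  fun x => `[< cs_set E x >].

(* E as a Hilbert space in its own right, with the inherited inner product. *)
Record subspace_type (R : realType) (H : hilbertType R)
    (E : closed_subspace H) :=
  SubspaceVec { sub_val : H; _ : sub_val \in cs_mem E }.

Section subspace_hilbert.
Context {R : realType} {H : hilbertType R} (E : closed_subspace H).

Lemma cs_mem_submod : submod_closed (cs_mem E).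
Proof.
have [E0 El] := cs_linear E; split; first exact/asboolP.
by move=> a x y /asboolP Ex /asboolP Ey; apply/asboolP/El.
Qed.

HB.instance Definition _ := GRing.isSubmodClosed.Build R[i] H (cs_mem E)
  cs_mem_submod.
HB.instance Definition _ := [isSub for @sub_val R H E].
HB.instance Definition _ := [Choice of subspace_type E by <:].
HB.instance Definition _ :=
  [SubChoice_isSubLmodule of subspace_type E by <:].

Definition sub_inner (x y : subspace_type E) : R[i] := inner (val x) (val y).

Lemma sub_inner_bilinear :
  bilinear_for *%R (Num.conj \; *%R) sub_inner.
Proof.
by split=> [y a x x'|x a y y']; rewrite /sub_inner linearP/=
  ?linearDl ?linearZl_LR ?linearDr ?linearZr_LR.
Qed.
HB.instance Definition _ := bilinear_isBilinear.Build R[i] (subspace_type E)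
  (subspace_type E) R[i] *%R (Num.conj \; *%R) sub_inner sub_inner_bilinear.

Lemma sub_inner_herm (x y : subspace_type E) :
  sub_inner x y = (-1) ^+ false * Num.conj (sub_inner y x).
Proof. exact: hermC. Qed.
HB.instance Definition _ := isHermitianSesquilinear.Build R[i] (subspace_type E)
  false Num.conj sub_inner sub_inner_herm.

Lemma sub_inner_gt0 (x : subspace_type E) : x != 0 -> 0 < sub_inner x x.
Proof. by move=> x0; rewrite /sub_inner dnorm_gt0. Qed.
HB.instance Definition _ := isDotProduct.Build R[i] (subspace_type E)
  sub_inner sub_inner_gt0.

Lemma sqnorm_subB (x y : subspace_type E) :
  sqnorm sub_inner (x - y) = sqnorm inner (val x - val y).
Proof.
by congr (sqnorm inner); exact: (raddfB (val : subspace_type E -> H)).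
Qed.

Lemma sub_inner_complete (F : set_system (subspace_type E)) : ProperFilter F ->
    (forall e : R, 0 < e ->
      exists x, F [set y | sqnorm sub_inner (x - y) < e]) ->
  exists l, forall e : R, 0 < e -> F [set y | sqnorm sub_inner (l - y) < e].
Proof.
move=> FF Fc; pose G : set_system H := val @ F.
have /cvg_ex[l Gl] : cvg G.
  apply: sqnorm_cauchy_cvg => e /Fc[x Fx]; exists (val x).
  rewrite /G /fmap/=; apply: filterS Fx => y xye.
  by rewrite /= -[_ - _]/(val x - val y) -sqnorm_subB; exact: xye.
have El : l \in cs_mem E.
  have El' : \forall x \near F, cs_set E (val x).
    by apply: nearW => x; apply/asboolP; case: x.
  apply/asboolP.
  exact: (@closed_cvg _ _ F _ val (cs_set E) (@cs_closed _ _ E) El' l Gl).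
exists (SubspaceVec El) => e e0.
have Fle : F [set y | sqnorm inner (l - val y) < e].
  exact: (cvg_sqnorm _ Gl e0).
apply: filterS Fle => y lye.
by rewrite /= sqnorm_subB; exact: lye.
Qed.

HB.instance Definition _ := Lmodule_isHilbert.Build R (subspace_type E)
  sub_inner_complete.

End subspace_hilbert.

#[local] Existing Instance totally_filter.

Section unordered_sum.
Context {S : choiceType}.

Lemma partial_sumE (V : zmodType) (x : S -> V) (A : {fset S}) :
  partial_sum x A = \sum_(i <- A) x i.
Proof. by rewrite big_seq_fsetE. Qed.

Lemma partial_sumD (V : zmodType) (x y : S -> V) :
  partial_sum (fun s => x s + y s) = partial_sum x \+ partial_sum y.
Proof. by apply/funext => A; rewrite /partial_sum/= big_split. Qed.

Lemma partial_sumZ (K : nzRingType) (V : lmodType K) (a : K) (x : S -> V) :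
  partial_sum (fun s => a *: x s) = a \*: partial_sum x.
Proof. by apply/funext => A; rewrite /partial_sum/= scaler_sumr. Qed.

Lemma partial_sum_le (R : realDomainType) (x : S -> R) (A B : {fset S}) :
  (forall s, 0 <= x s) -> (A `<=` B)%fset -> partial_sum x A <= partial_sum x B.
Proof.
move=> x0 /fsubsetP AB; rewrite !partial_sumE (big_fsetID _ [in A] B)/=.
have -> : [fset s in B | s \in A]%fset = A.
  by apply/fsetP => s; rewrite !inE andbC; case: (boolP (s \in A)) => // /AB ->.
by rewrite lerDl sumr_ge0.
Qed.

Lemma nneg_sum_cvg (R : realType) (x : S -> R) (M : R) :
    (forall s, 0 <= x s) -> (forall A, partial_sum x A <= M) ->
  exists l : R, [/\ partial_sum x @ totally --> l,
    forall A, partial_sum x A <= l & l <= M].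
Proof.
move=> x0 xM.
have supx : has_sup (range (partial_sum x)).
  by split; [exists (partial_sum x fset0), fset0|exists M => _ [A _ <-]].
have lex A : partial_sum x A <= sup (range (partial_sum x)).
  by apply: ub_le_sup; [case: supx|exists A].
exists (sup (range (partial_sum x))); split => //; last first.
  by apply: ge_sup => [|_ [A _ <-]//]; case: supx.
apply/cvgrPdist_lt => e e0.
have [_ [A _ <-] Ae] := sup_adherent e0 supx.
exists A => // B /= AB; rewrite ger0_norm ?subr_ge0//.
by rewrite ltrBlDr addrC -ltrBlDr (lt_le_trans Ae)// partial_sum_le.
Qed.

Lemma sum_cvgD (K : numFieldType) (V : normedModType K) (x y : S -> V)
    (l m : V) :
    partial_sum x @ totally --> l -> partial_sum y @ totally --> m ->
  partial_sum (fun s => x s + y s) @ totally --> l + m.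
Proof. by move=> xl ym; rewrite partial_sumD; exact: cvgD. Qed.

Lemma sum_cvgZ (K : numFieldType) (V : normedModType K) (a : K) (x : S -> V)
    (l : V) :
  partial_sum x @ totally --> l ->
  partial_sum (fun s => a *: x s) @ totally --> a *: l.
Proof. by move=> xl; rewrite partial_sumZ; exact: cvgZl_tmp. Qed.

Lemma sumP (K : numFieldType) (V : normedModType K) (x : S -> V) (l : V) :
  partial_sum x @ totally --> l -> sum x = l.
Proof. by move=> xl; exact: cvg_lim. Qed.

Lemma cvg_realC (R : realType) (T : Type) (F : set_system T) (x : T -> R)
    (l : R) :
  Filter F -> x @ F --> l ->
  (fun t => (x t)%:C%C : R[i]^o) @ F --> (l%:C%C : R[i]^o).
Proof.
move=> FF /cvgrPdist_lt xl; apply/cvgrPdist_lt => e e0.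
have e1 : 0 < complex.Re e by move: e0; rewrite ltcE => /andP[].
apply: filterS (xl _ e1) => t.
rewrite -rmorphB normc_def/= expr0n addr0 sqrtr_sqr.
by rewrite ltcE/=; move: e0; rewrite ltcE/= => /andP[-> _].
Qed.

Lemma cvg_conjC (R : realType) (T : Type) (F : set_system T) (x : T -> R[i])
    (l : R[i]) :
  Filter F -> (x : T -> R[i]^o) @ F --> (l : R[i]^o) ->
  (fun t => Num.conj (x t) : R[i]^o) @ F --> (Num.conj l : R[i]^o).
Proof.
move=> FF /cvgrPdist_lt xl; apply/cvgrPdist_lt => e e0.
by apply: filterS (xl _ e0) => t; rewrite -rmorphB/= norm_conjC.
Qed.

End unordered_sum.

Section square_summable.
Context {R : realType} {S : choiceType} (H : S -> hilbertType R).
Implicit Types f g : forall s, H s.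

Definition square_summable f : Prop :=
  (\esum_(s in [set: S]) (sqnorm inner (f s))%:E < +oo)%E.

Lemma square_summableP f : square_summable f <->
  exists M, forall A, partial_sum (fun s => sqnorm inner (f s)) A <= M.
Proof.
have sq0 s : (0 <= (sqnorm inner (f s))%:E)%E by rewrite lee_fin sqnorm_ge0.
split=> [|[M fM]].
  rewrite /square_summable => fo.
  have f0 : (0 <= \esum_(s in [set: S]) (sqnorm inner (f s))%:E)%E.
    exact: esum_ge0.
  exists (fine (\esum_(s in [set: S]) (sqnorm inner (f s))%:E)) => A.
  rewrite -lee_fin fineK ?ge0_fin_numE// partial_sumE -sumEFin.
  apply: ereal_sup_ubound; exists [set` A]; first by split.
  by rewrite fsbig_finite// set_fsetK.
apply: (@le_lt_trans _ _ M%:E); last exact: ltry.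
apply: ub_ereal_sup => _ [A [finA _] <-].
by rewrite fsbig_finite// sumEFin lee_fin -partial_sumE.
Qed.

Lemma sqnorm_le (V : lmodType R[i]) (q : {dot V for Num.conj}) x y :
  sqnorm q (x + y) <= 2 * sqnorm q x + 2 * sqnorm q y.
Proof.
have := sqnorm_ge0 q (x - y); rewrite !sqnormD linearNr raddfN/=.
rewrite {2}/sqnorm hnormN -/(sqnorm q y); lra.
Qed.

Lemma polarization (V : lmodType R[i]) (q : {dot V for Num.conj}) x y :
  q x y =
    2^-1 * ((sqnorm q (x + y))%:C%C - ((sqnorm q x)%:C%C + (sqnorm q y)%:C%C)) +
    (2^-1 * 'i%C) *
      ((sqnorm q (x + 'i%C *: y))%:C%C -
       ((sqnorm q x)%:C%C + (sqnorm q y)%:C%C)).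
Proof.
have niy : sqnorm q ('i%C *: y) = sqnorm q y.
  by apply: complexI; rewrite sqnormZ normc_def/= expr0n/= add0r expr1n sqrtr1
    expr1n mul1r.
rewrite !sqnormD niy linearZr_LR/=.
apply: (@mulfI _ 2); first by rewrite pnatr_eq0.
rewrite mulrDr !mulrA divff ?pnatr_eq0// !mul1r.
case: (q x y) => a b; apply/eqP; rewrite eq_complex/=.
by apply/andP; split; apply/eqP => /=; ring.
Qed.

Lemma square_summable0 : square_summable (fun s => 0).
Proof.
apply/square_summableP; exists 0 => A; rewrite partial_sumE big1// => s _.
by rewrite /sqnorm linear0r.
Qed.

Lemma square_summableD f g : square_summable f -> square_summable g ->
  square_summable (fun s => f s + g s).
Proof.
move=> /square_summableP[M fM] /square_summableP[M' gM'].
apply/square_summableP; exists (2 * M + 2 * M') => A.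
apply: (@le_trans _ _ (2 * partial_sum (fun s => sqnorm inner (f s)) A +
   2 * partial_sum (fun s => sqnorm inner (g s)) A)).
  rewrite !partial_sumE !mulr_sumr -big_split/= ler_sum// => s _.
  exact: sqnorm_le.
by have := fM A; have := gM' A; lra.
Qed.

Lemma square_summableZ (a : R[i]) f : square_summable f ->
  square_summable (fun s => a *: f s).
Proof.
move=> /square_summableP[M fM]; apply/square_summableP.
have [b b0 bE] : exists2 b : R, 0 <= b & `|a| ^+ 2 = b%:C%C.
  exists (complex.Re a ^+ 2 + complex.Im a ^+ 2).
    by rewrite addr_ge0 ?sqr_ge0.
  by rewrite normc_def -rmorphXn sqr_sqrtr ?addr_ge0 ?sqr_ge0.
exists (b * M) => A; apply: (le_trans _ (ler_wpM2l b0 (fM A))).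
rewrite !partial_sumE mulr_sumr ler_sum// => s _.
by rewrite -lecR sqnormZ bE rmorphM.
Qed.

Lemma sqnorm_sum_cvg f : square_summable f -> exists l : R,
  [/\ partial_sum (fun s => sqnorm inner (f s)) @ totally --> l,
    forall A, partial_sum (fun s => sqnorm inner (f s)) A <= l &
    forall M, (forall A, partial_sum (fun s => sqnorm inner (f s)) A <= M) ->
      l <= M].
Proof.
have f0 s : 0 <= sqnorm inner (f s) by exact: sqnorm_ge0.
move=> /square_summableP[M fM].
have [l [fl lel _]] := nneg_sum_cvg f0 fM; exists l; split => // M' fM'.
have [l' [fl' _ +]] := nneg_sum_cvg f0 fM'.
by rewrite (cvg_unique _ fl fl').
Qed.

Lemma inner_sum_cvg f g : square_summable f -> square_summable g ->
  exists l : R[i]^o,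
    partial_sum (fun s => inner (f s) (g s) : R[i]^o) @ totally --> l.
Proof.
move=> ff gg.
have sqC h : square_summable h -> exists l : R[i]^o,
    partial_sum (fun s => (sqnorm inner (h s))%:C%C : R[i]^o) @ totally --> l.
  move=> /sqnorm_sum_cvg[l [hl _ _]]; exists (l%:C%C).
  rewrite (_ : partial_sum _ =
    fun A => (partial_sum (fun s => sqnorm inner (h s)) A)%:C%C).
    exact: cvg_realC.
  by apply/funext => A; rewrite /partial_sum rmorph_sum.
have [a fa] := sqC _ ff; have [b gb] := sqC _ gg.
have [c fgc] := sqC _ (square_summableD ff gg).
have [d fgd] := sqC _ (square_summableD ff (square_summableZ 'i%C gg)).
have ab := sum_cvgZ (a := -1) (sum_cvgD fa gb).
have := sum_cvgD (sum_cvgZ (a := 2^-1) (sum_cvgD fgc ab))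
                 (sum_cvgZ (a := 2^-1 * 'i%C) (sum_cvgD fgd ab)).
set l := (X in _ --> X) => fgl; exists l; move: fgl.
congr (partial_sum _ @ totally --> l); apply/funext => s.
rewrite !scaleN1r.
exact/esym/polarization.
Qed.
End square_summable.

(* The Hilbert space direct sum: all square-summable families, with inner product
   the unordered sum of the inner products of the coordinates. *)
Record hilbert_sum (R : realType) (S : choiceType) (H : S -> hilbertType R) :=
  HilbertSum { hcoord : forall s, H s; hcoordP : square_summable hcoord }.

Section hilbert_sum.
Context {R : realType} {S : choiceType} (H : S -> hilbertType R).
Local Notation V := (hilbert_sum H).

HB.instance Definition _ := gen_eqMixin V.
HB.instance Definition _ := gen_choiceMixin V.

Lemma hcoord_inj : injective (@hcoord R S H).
Proof.
move=> [f fP] [g gP] /= fg; subst g; congr HilbertSum; exact: Prop_irrelevance.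
Qed.

Lemma hsum_eq (x y : V) : (forall s, hcoord x s = hcoord y s) -> x = y.
Proof. by move=> xy; apply/hcoord_inj/functional_extensionality_dep. Qed.

Definition hsum0 : V := HilbertSum (square_summable0 H).
Definition hsumZ (a : R[i]) (x : V) : V :=
  HilbertSum (square_summableZ a (hcoordP x)).
Definition hsumN (x : V) : V := hsumZ (-1) x.
Definition hsumD (x y : V) : V :=
  HilbertSum (square_summableD (hcoordP x) (hcoordP y)).

Lemma hsumDA : associative hsumD.
Proof. by move=> x y z; apply: hsum_eq => s /=; rewrite addrA. Qed.
Lemma hsumDC : commutative hsumD.
Proof. by move=> x y; apply: hsum_eq => s /=; rewrite addrC. Qed.
Lemma hsum0D : left_id hsum0 hsumD.
Proof. by move=> x; apply: hsum_eq => s /=; rewrite add0r. Qed.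
Lemma hsumND : left_inverse hsum0 hsumN hsumD.
Proof. by move=> x; apply: hsum_eq => s /=; rewrite scaleN1r addNr. Qed.
HB.instance Definition _ := GRing.isZmodule.Build V hsumDA hsumDC hsum0D hsumND.

Lemma hsumZA (a b : R[i]) (x : V) : hsumZ a (hsumZ b x) = hsumZ (a * b) x.
Proof. by apply: hsum_eq => s /=; rewrite scalerA. Qed.
Lemma hsum1Z : left_id 1 hsumZ.
Proof. by move=> x; apply: hsum_eq => s /=; rewrite scale1r. Qed.
Lemma hsumZDr : right_distributive hsumZ +%R.
Proof. by move=> a x y; apply: hsum_eq => s /=; rewrite scalerDr. Qed.
Lemma hsumZDl (x : V) : {morph hsumZ^~ x : a b / a + b}.
Proof. by move=> a b; apply: hsum_eq => s /=; rewrite scalerDl. Qed.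
HB.instance Definition _ := GRing.Zmodule_isLmodule.Build R[i] V
  hsumZA hsum1Z hsumZDr hsumZDl.

Lemma hcoordB (x y : V) s : hcoord (x - y) s = hcoord x s - hcoord y s.
Proof. by rewrite /= scaleN1r. Qed.

Definition hsum_inner (x y : V) : R[i] :=
  sum (fun s => inner (hcoord x s) (hcoord y s) : R[i]^o).

Lemma hsum_innerP (x y : V) :
  partial_sum (fun s => inner (hcoord x s) (hcoord y s) : R[i]^o) @ totally
    --> (hsum_inner x y : R[i]^o).
Proof.
have [l xyl] := inner_sum_cvg (hcoordP x) (hcoordP y).
by rewrite /hsum_inner (sumP xyl).
Qed.

Lemma hsum_innerE (x y : V) (l : R[i]^o) :
    partial_sum (fun s => inner (hcoord x s) (hcoord y s) : R[i]^o) @ totally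
      --> l ->
  hsum_inner x y = l.
Proof. exact: sumP. Qed.

Lemma hsum_inner_linear (y : V) a (x x' : V) :
  hsum_inner (a *: x + x') y = a * hsum_inner x y + hsum_inner x' y.
Proof.
apply: hsum_innerE.
rewrite (_ : (fun s => _) = fun s =>
    a *: (inner (hcoord x s) (hcoord y s) : R[i]^o) +
    inner (hcoord x' s) (hcoord y s)).
  exact: sum_cvgD (sum_cvgZ (@hsum_innerP x y)) (@hsum_innerP x' y).
by apply/funext => s; rewrite /= linearDl/= linearZl_LR.
Qed.

Lemma hsum_inner_herm (x y : V) :
  hsum_inner x y = (-1) ^+ false * Num.conj (hsum_inner y x).
Proof.
rewrite expr0 mul1r; apply: hsum_innerE.
rewrite (_ : partial_sum _ = fun A => Num.conj
    (partial_sum (fun s => inner (hcoord y s) (hcoord x s) : R[i]^o) A)).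
  exact: cvg_conjC (@hsum_innerP y x).
apply/funext => A; rewrite /partial_sum rmorph_sum; apply: eq_bigr => s _.
by rewrite [LHS]hermC expr0 mul1r.
Qed.

Lemma hsum_inner_bilinear : bilinear_for *%R (Num.conj \; *%R) hsum_inner.
Proof.
split=> [y a x x'|x a y y'] /=; first exact: hsum_inner_linear.
rewrite hsum_inner_herm expr0 mul1r hsum_inner_linear rmorphD rmorphM/=.
by rewrite (hsum_inner_herm x y) (hsum_inner_herm x y') expr0 !mul1r.
Qed.
HB.instance Definition _ := bilinear_isBilinear.Build R[i] V V R[i]
  *%R (Num.conj \; *%R) hsum_inner hsum_inner_bilinear.
HB.instance Definition _ := isHermitianSesquilinear.Build R[i] V
  false Num.conj hsum_inner hsum_inner_herm.

Lemma hsum_sqnormP (x : V) : exists l : R,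
  [/\ hsum_inner x x = l%:C%C,
    forall A, partial_sum (fun s => sqnorm inner (hcoord x s)) A <= l &
    forall M, (forall A,
      partial_sum (fun s => sqnorm inner (hcoord x s)) A <= M) -> l <= M].
Proof.
have [l [xl lel lM]] := sqnorm_sum_cvg (hcoordP x); exists l; split => //.
apply: hsum_innerE.
rewrite (_ : partial_sum _ = fun A =>
    (partial_sum (fun s => sqnorm inner (hcoord x s)) A)%:C%C).
  exact: cvg_realC xl.
apply/funext => A; rewrite /partial_sum rmorph_sum; apply: eq_bigr => s _.
by rewrite dot_sqnorm.
Qed.

Lemma hsum_inner_gt0 (x : V) : x != 0 -> 0 < hsum_inner x x.
Proof.
move=> x0; have [l [-> lel _]] := hsum_sqnormP x; rewrite ltcE/= eqxx/=.
have [s xs0] : exists s, hcoord x s != 0.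
  apply: contrapT => /forallNP x00; move/eqP: x0; apply; apply: hcoord_inj.
  by apply: functional_extensionality_dep => s; apply/eqP/negPn/negP/x00.
apply: lt_le_trans (lel [fset s]%fset); rewrite partial_sumE big_seq_fset1.
by move: xs0; rewrite -(dnorm_gt0 inner) dot_sqnorm ltcE/= => /andP[].
Qed.
HB.instance Definition _ := isDotProduct.Build R[i] V hsum_inner hsum_inner_gt0.

Lemma hsum_sqnorm_ub (x : V) A :
  partial_sum (fun s => sqnorm inner (hcoord x s)) A <= sqnorm hsum_inner x.
Proof. by have [l [xl lel _]] := hsum_sqnormP x; rewrite /sqnorm/= xl. Qed.

Lemma hsum_sqnorm_le (x : V) M :
  (forall A, partial_sum (fun s => sqnorm inner (hcoord x s)) A <= M) ->
  sqnorm hsum_inner x <= M.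
Proof.
by move=> xM; have [l [xl _ lM]] := hsum_sqnormP x; rewrite /sqnorm/= xl lM.
Qed.

Lemma hsum_complete (F : set_system V) : ProperFilter F ->
    (forall e : R, 0 < e ->
      exists x, F [set y | sqnorm hsum_inner (x - y) < e]) ->
  exists l, forall e : R, 0 < e -> F [set y | sqnorm hsum_inner (l - y) < e].
Proof.
move=> FF Fc.
have coordF s : exists l : H s, (fun x : V => hcoord x s) @ F --> l.
  apply/cvg_ex; apply: sqnorm_cauchy_cvg => e /Fc[x Fx]; exists (hcoord x s).
  have : F [set y | sqnorm inner (hcoord x s - hcoord y s) < e]; last exact.
  apply: filterS Fx => y; apply: le_lt_trans.
  apply: le_trans (hsum_sqnorm_ub _ [fset s]%fset).
  by rewrite partial_sumE big_seq_fset1 hcoordB.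
have {coordF}[l lF] : exists l : forall s, H s,
    forall s, (fun x : V => hcoord x s) @ F --> l s.
  exists (fun s => projT1 (cid (coordF s))) => s.
  exact: projT2 (cid (coordF s)).
have key (x : V) (e : R) : 0 < e -> F [set y | sqnorm hsum_inner (x - y) < e] ->
    forall A, partial_sum (fun s => sqnorm inner (hcoord x s - l s)) A <= 4 * e.
  move=> e0 Fx A; pose d := e / (#|{: A}|%:R + 1).
  have d0 : 0 < d by rewrite divr_gt0// ltr_wpDl.
  have Fl : F [set y | forall i : A,
      sqnorm inner (l (val i) - hcoord y (val i)) < d].
    apply: filter_forall => i; have := cvg_sqnorm _ (lF (val i)) d0; exact.
  have [y [xye lyd]] := filter_ex (filterI Fx Fl).
  apply: (@le_trans _ _ (2 * e + 2 * e)); last lra.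
  apply: (@le_trans _ _
    (2 * partial_sum (fun s => sqnorm inner (hcoord (x - y) s)) A
     + 2 * partial_sum (fun s => sqnorm inner (l s - hcoord y s)) A)).
    rewrite /partial_sum !mulr_sumr -big_split/= ler_sum// => i _.
    set u := hcoord x _; set v := hcoord y _; set w := l _.
    have -> : u - w = (u - v) + - (w - v) by rewrite opprB addrA subrK.
    rewrite (le_trans (sqnorm_le _ _ _))// scaleN1r lerD2l ler_pM2l//.
    by rewrite {1}/sqnorm hnormN.
  rewrite lerD// ler_pM2l//.
    exact: le_trans (hsum_sqnorm_ub _ _) (ltW xye).
  apply: (@le_trans _ _ (\sum_(i : A) d)).
    by rewrite /partial_sum ler_sum// => i _; rewrite ltW.
  rewrite sumr_const -mulr_natl /d mulrCA ger_pMr//.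
  by rewrite ler_pdivrMr ?ltr_wpDl// mul1r lerDl.
have lsq : square_summable l.
  have [x Fx] := Fc 1 ltr01.
  have xl : square_summable (fun s => hcoord x s - l s).
    by apply/square_summableP; exists (4 * 1); exact: key.
  have := square_summableD (hcoordP x) (square_summableZ (-1) xl).
  congr (square_summable _); apply: functional_extensionality_dep => s.
  by rewrite scaleN1r opprB addrC subrK.
exists (HilbertSum lsq) => e e0.
have e16 : 0 < e / 16 by rewrite divr_gt0.
have [x Fx] := Fc _ e16; apply: filterS (Fx) => y /= xye.
have -> : HilbertSum lsq - y = (x - y) + - (x - HilbertSum lsq).
  by rewrite opprB [RHS]addrC addrA subrK.
apply: le_lt_trans (sqnorm_le _ _ _) _.
have : sqnorm hsum_inner (- (x - HilbertSum lsq)) <= 4 * (e / 16).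
  rewrite {1}/sqnorm hnormN; apply: hsum_sqnorm_le => A.
  have := key x _ e16 Fx A; congr (partial_sum _ A <= _).
  by apply/funext => s; rewrite hcoordB.
by move: xye; lra.
Qed.

HB.instance Definition _ := Lmodule_isHilbert.Build R V hsum_complete.

End hilbert_sum.

Section subspace_lattice.
Context {R : realType} {H : hilbertType R}.
Implicit Types E K L : closed_subspace H.

Lemma nbhs_sqnorm (l : H) (e : R) : 0 < e ->
  nbhs l [set x | sqnorm inner (l - x) < e].
Proof. by move=> e0; apply: (@cvg_sqnorm _ _ (nbhs l) l). Qed.

Lemma orthogonal_set_linear (A : set H) :
  let B := [set x : H | forall y, A y -> inner x y = 0] in
  B 0 /\ forall (a : R[i]) x y, B x -> B y -> B (a *: x + y).
Proof.
split=> [y _|a x y Bx By z Az]; first by rewrite linear0l.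
by rewrite linearDl/= linearZl_LR/= Bx// By// mulr0 addr0.
Qed.

Lemma orthogonal_set_closed E :
  closed [set x : H | forall y, cs_set E y -> inner x y = 0].
Proof.
move=> l clEl.
have Rel y : cs_set E y -> complex.Re (inner l y) = 0.
  move=> Ey; apply/eqP; rewrite -sqrf_eq0; apply/negP => /negP z0.
  set c := complex.Re _ ^+ 2 in z0.
  have c0 : 0 < c by rewrite lt_def z0 sqr_ge0.
  have d0 : 0 < c / (sqnorm inner y + 1).
    by rewrite divr_gt0// ltr_wpDl// sqnorm_ge0.
  have [x [Ex]] := clEl _ (nbhs_sqnorm l d0).
  rewrite /= ltr_pdivlMr ?ltr_wpDl ?sqnorm_ge0// ltNge => /negP; apply.
  have := dot_cauchy_schwarz inner (l - x) y.
  rewrite linearBl/= Ex// subr0 -/c => /le_trans; apply.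
  by rewrite ler_wpM2l ?sqnorm_ge0// lerDl.
move=> y Ey; apply/eqP; rewrite eq_complex/= Rel// eqxx/=; apply/eqP.
have [E0 El] := cs_linear E.
have := Rel _ (El 'i%C _ _ Ey E0); rewrite addr0 linearZr_LR/=.
by case: (inner l y) => a b /=; lra.
Qed.

Definition orthocomplement E : closed_subspace H :=
  ClosedSubspace (orthogonal_set_linear (cs_set E)) (@orthogonal_set_closed E).

Lemma span_linear (F : set (closed_subspace H)) :
  let B := [set x : H | forall L,
    (forall K, F K -> cs_set K `<=` cs_set L) -> cs_set L x] in
  B 0 /\ forall (a : R[i]) x y, B x -> B y -> B (a *: x + y).
Proof.
split=> [L _|a x y Bx By L FL]; first by case: (cs_linear L).
by have [_ Ll] := cs_linear L; apply: Ll; [exact: Bx|exact: By].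
Qed.

Lemma span_closed (F : set (closed_subspace H)) :
  closed [set x : H | forall L,
    (forall K, F K -> cs_set K `<=` cs_set L) -> cs_set L x].
Proof.
move=> l cll L FL; apply: (@cs_closed _ _ L); apply: closureS cll => x.
exact.
Qed.

(* The intersection of all closed subspaces that contain every member of F. *)
Definition closed_span (F : set (closed_subspace H)) : closed_subspace H :=
  ClosedSubspace (span_linear F) (@span_closed F).

(* E is complete, so such a y exists and is unique: the default 0 is not used. *)
Definition orth_proj E (x : H) : H :=
  xget 0 [set y | cs_set E y /\ forall z, cs_set E z -> inner (x - y) z = 0].

End subspace_lattice.

(* The operator is the restriction of app to dom: the values of app outside dom
   are irrelevant, and nothing below depends on them. *)
Record partial_op (R : realType) (H : hilbertType R) :=
  PartialOp { dom : set H; app : H -> H }.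

Section operators.
Context {R : realType}.

Definition linear_op (H : hilbertType R) (A : partial_op H) : Prop :=
  dom A 0 /\ forall (a : R[i]) x y, dom A x -> dom A y ->
    dom A (a *: x + y) /\ app A (a *: x + y) = a *: app A x + app A y.

Definition op_graph (H : hilbertType R) (A : partial_op H) : set (H * H) :=
  [set p | dom A p.1 /\ p.2 = app A p.1].

Definition closed_densely_defined (H : hilbertType R) (A : partial_op H) : Prop :=
  [/\ linear_op A, closed (op_graph A) & dense (dom A)].

Definition reduces (H : hilbertType R) (A : partial_op H)
    (E : closed_subspace H) : Prop :=
  forall x, dom A x ->
    dom A (orth_proj E x) /\ app A (orth_proj E x) = orth_proj E (app A x).

(* insubd 0 views app A x as an element of E. When E reduces A, app A x lies in E
   for every x in dom A `&` E, and the default 0 is not used there. *)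
Definition restr_op (H : hilbertType R) (A : partial_op H)
    (E : closed_subspace H) : partial_op (subspace_type E) :=
  @PartialOp R (subspace_type E) [set x | dom A (sub_val x)]
    (fun x => insubd 0 (app A (sub_val x))).

Definition sum_op (S : choiceType) (H : S -> hilbertType R)
    (A : forall s, partial_op (H s)) : partial_op (hilbert_sum H) :=
  @PartialOp R (hilbert_sum H)
    [set x | (forall s, dom (A s) (hcoord x s)) /\
             square_summable (fun s => app (A s) (hcoord x s))]
    (fun x => if pselect (square_summable (fun s => app (A s) (hcoord x s)))
              is left Ax then HilbertSum Ax else 0).

End operators.

Record op_tuple (R : realType) (N : nat) := OpTuple {
  op_space : hilbertType R;
  op :> 'I_N -> partial_op op_space
}.

Section tuples.
Context {R : realType} {N : nat}.
Implicit Types A B X T : op_tuple R N.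

Definition CDD A : Prop := forall j, closed_densely_defined (A j).

Definition trivial A : Prop := forall x : op_space A, x = 0.

Definition red A : set (closed_subspace (op_space A)) :=
  [set E | forall j, reduces (A j) E].
Arguments red A E : clear implicits.

Definition cred A : set (closed_subspace (op_space A)) :=
  [set E | red A E /\ forall K, red A K ->
    forall x, orth_proj E (orth_proj K x) = orth_proj K (orth_proj E x)].
Arguments cred A E : clear implicits.

Definition restr A (E : closed_subspace (op_space A)) : op_tuple R N :=
  OpTuple (fun j => restr_op (A j) E).
Arguments restr A E : clear implicits.

Definition direct_sum (S : choiceType) (A : S -> op_tuple R N) : op_tuple R N :=
  OpTuple (fun j => sum_op (fun s => A s j)).

Definition unitary (H K : hilbertType R) (U : {linear H -> K}) : Prop :=
  bijective U /\ forall x y, inner (U x) (U y) = inner x y.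

(* A j = U^-1 (B j) U, with dom (U^-1 (B j) U) = U^-1 (dom (B j)). *)
Definition unitarily_equivalent A B : Prop :=
  exists U : {linear op_space A -> op_space B}, unitary U /\
    forall j, dom (A j) = U @^-1` dom (B j) /\
      forall x, dom (A j) x -> U (app (A j) x) = app (B j) (U x).

Definition tuple_le A B : Prop :=
  exists2 E, red B E & unitarily_equivalent A (restr B E).

Definition unitarily_disjoint A B : Prop :=
  ~ exists X, [/\ CDD X, ~ trivial X, tuple_le X A & tuple_le X B].

(* A class of tuples is a predicate; closure under unitary equivalence makes it
   independent of the irrelevant values of app. *)
Record ideal (calA : op_tuple R N -> Prop) : Prop := {
  ideal_CDD : forall A, calA A -> CDD A;
  ideal_nonempty : exists A, calA A;
  ideal_equivalent : forall A B,
    calA A -> CDD B -> unitarily_equivalent A B -> calA B;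
  ideal_restrict : forall A E, calA A -> red A E -> calA (restr A E);
  ideal_direct_sum : forall (S : choiceType) (A : S -> op_tuple R N),
    inhabited S -> (forall s, calA (A s)) -> calA (direct_sum A)
}.

Definition disjoint_class (F : op_tuple R N -> Prop) (T : op_tuple R N) : Prop :=
  CDD T /\ forall A, F A -> unitarily_disjoint T A.

End tuples.

Arguments red {R N} A E.
Arguments cred {R N} A E.
Arguments restr {R N} A E.

(* Main.v *)
From HB Require Import structures.
Require Import Defs.
From mathcomp Require Import all_boot all_order all_algebra.
From mathcomp Require Import complex sesquilinear finmap.
From mathcomp Require Import boolp classical_sets reals.
From mathcomp Require Import topology normedtype.
From mathcomp.analysis Require Import showcase.summability.
From mathcomp Require Import ring lra.

(** Call a reducing subspace K of T good when the restriction of T to K lies in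
the ideal; all good subspaces should fit into one, the E of the theorem.

Existence is a maximality argument. Among the sets of pairwise orthogonal good
subspaces choose a maximal one by Zorn's lemma, and let E be its closed span.
By Parseval's identity the map sending x to the family of its projections is an
isometry of E into the Hilbert sum of the chosen subspaces, and it identifies
the restriction of T to E with a reducing part of a direct sum of members of the
ideal; so E is good. A nontrivial tuple below both the restriction to the
complement of E and a member of the ideal would be realised on a good subspace
orthogonal to E, against maximality ([exists_decomposition]).

For uniqueness and for the formula it is enough to show that any E as in the
theorem contains every good K ([good_le]): being good itself, E is then the
closed span of the good subspaces. The usual proof takes the polar
decomposition of the product of the projections onto K and onto the complement
of E. Here no functional calculus is needed, because an ideal is closed under
infinite direct sums. Take x in the complement of E, peel off its component in
K, then the component of the remainder in E, then again in K, and so on. By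
Pythagoras the squared norms of the peeled components add up to |x|^2 minus the
limit of the squared norms of the remainders. The remainders are the alternating
projections of x between the complements of E and K; they tend to 0 when x is
orthogonal to the intersection of these two complements. On the subspace W of
such x, peeling is thus an isometry into a direct sum of copies of the
restrictions of T to K and to E, and it commutes with T, so W is good
([good_angle_part]). As W lies in the complement of E, which contains no
nonzero good subspace, W = 0: the complement of E is contained in the complement
of K.

Finally E commutes with every reducing subspace K. The reflection in K is a
unitary that commutes with T, so it maps the good subspace E to a good subspace,
which E contains; hence E is invariant under the projection onto K
([good_invariant]).

All constructions of good subspaces rest on two facts about operators that
intertwine two tuples together with their adjoints: the range of an isometric
one is reducing and carries a copy of its source ([isometry_range]), and a tuple
that maps into members of the ideal by such operators C_s, with
|x|^2 = sum_s |C_s x|^2, is itself in the ideal ([ideal_isometric_family]). *)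

Set Implicit Arguments.
Unset Strict Implicit.
Unset Printing Implicit Defensive.

Import Order.TTheory GRing.Theory Num.Theory.
Import numFieldNormedType.Exports.

Local Open Scope classical_set_scope.
Local Open Scope ring_scope.

(** * Hilbert space geometry and the projection theorem *)

Section hilbert_geometry.
Context {R : realType} {H : hilbertType R}.
Implicit Types (x y z : H) (E : closed_subspace H).

(** [sqnorm inner] carries its module structure and its form as parameters; with
the Hilbert space as the only one, rewriting need not compare those. *)
Definition sq x : R := sqnorm inner x.

Lemma sq_ge0 x : 0 <= sq x. Proof. exact: sqnorm_ge0. Qed.

Lemma sq_eq0 x : sq x = 0 -> x = 0. Proof. exact: sqnorm_eq0. Qed.

Lemma sq0 : sq (0 : H) = 0.
Proof. by rewrite /sq /sqnorm linear0l. Qed.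

Lemma sqD x y : sq (x + y) = sq x + sq y + 2 * complex.Re (inner x y).
Proof. exact: sqnormD. Qed.

Lemma inner_cauchy_schwarz x y : complex.Re (inner x y) ^+ 2 <= sq x * sq y.
Proof. exact: dot_cauchy_schwarz. Qed.

Lemma sq_le_double x y : sq (x + y) <= 2 * sq x + 2 * sq y.
Proof. exact: (sqnorm_le inner). Qed.

Lemma innerxx x : inner x x = (sq x)%:C%C.
Proof. exact: dot_sqnorm. Qed.

Lemma innerC x y : inner y x = Num.conj (inner x y).
Proof. by rewrite [LHS]hermC expr0 mul1r. Qed.

Lemma inner_eq0C x y : inner x y = 0 -> inner y x = 0.
Proof. by move=> xy0; rewrite innerC xy0 rmorph0. Qed.

Lemma sqN x : sq (- x) = sq x.
Proof. by rewrite /sq /sqnorm hnormN. Qed.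

Lemma sqB x y : sq (x - y) = sq x + sq y - 2 * complex.Re (inner x y).
Proof. by rewrite sqD sqN linearNr raddfN/= mulrN. Qed.

Lemma sqBC x y : sq (x - y) = sq (y - x).
Proof. by rewrite -opprB sqN. Qed.

Lemma sqZ_complex (a : R[i]) x :
  sq (a *: x) = (complex.Re a ^+ 2 + complex.Im a ^+ 2) * sq x.
Proof.
apply: complexI; rewrite sqnormZ normc_def rmorphM; congr (_ * _).
by rewrite -rmorphXn sqr_sqrtr// addr_ge0 ?sqr_ge0.
Qed.

Lemma sqZ (a : R) x : sq (a%:C%C *: x) = a ^+ 2 * sq x.
Proof. by rewrite sqZ_complex/= expr0n addr0. Qed.

Lemma pythagoras x y : inner x y = 0 -> sq (x + y) = sq x + sq y.
Proof. by move=> xy0; rewrite sqD xy0 mulr0 addr0. Qed.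

Lemma inner_inj x y : (forall z, inner x z = inner y z) -> x = y.
Proof.
move=> xy; apply/eqP; rewrite -subr_eq0; apply/eqP/sq_eq0.
by rewrite /sq /sqnorm linearBl/= xy subrr.
Qed.

(** The imaginary part is covered by the multiple of z by the imaginary unit. *)
Lemma inner_eq0_re x z :
  (forall a, complex.Re (inner x (a *: z)) = 0) -> inner x z = 0.
Proof.
move=> xz0; apply/eqP; rewrite eq_complex/=; apply/andP; split; apply/eqP.
  by have := xz0 1; rewrite scale1r.
have := xz0 'i%C; rewrite linearZr_LR/=.
by case: (inner x z) => a b /=; lra.
Qed.

Lemma inner_eq0_approx x z :
  (forall e, 0 < e -> exists2 y, inner y z = 0 & sq (x - y) < e) ->
  inner x z = 0.
Proof.
move=> xz; apply: inner_eq0_re => a; apply/eqP; rewrite -sqrf_eq0 eq_le sqr_ge0.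
rewrite andbT; apply/ler_addgt0Pr => e e0; rewrite add0r.
have q0 : 0 < sq (a *: z) + 1 by rewrite ltr_wpDl ?sq_ge0.
have [y yz0 xye] := xz _ (divr_gt0 e0 q0).
have := inner_cauchy_schwarz (x - y) (a *: z).
rewrite linearBl/= [inner y (_ *: _)]linearZr_LR/= yz0 mulr0 subr0 => /le_trans; apply.
move: xye; rewrite ltr_pdivlMr// => xye; apply: le_trans (ltW xye).
by rewrite ler_wpM2l ?sq_ge0// lerDl.
Qed.

Lemma sq_small x : (forall e, 0 < e -> sq x < e) -> x = 0.
Proof.
move=> x0; apply: sq_eq0; apply/eqP; rewrite eq_le.
by rewrite sq_ge0 andbT; apply/ler_addgt0Pr => e /x0/ltW; rewrite add0r.
Qed.

Lemma nbhs_sqnormP x (B : set H) : nbhs x B ->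
  exists2 e, 0 < e & forall y, sq (x - y) < e -> B y.
Proof.
move=> /nbhs_ballP[e e0 eB].
have e1 : 0 < complex.Re e by move: e0; rewrite /= ltcE => /andP[].
have eE : e = (complex.Re e)%:C%C.
  by move: e0; case: (e) => a b; rewrite /= ltcE /= => /andP[/eqP ->].
exists (complex.Re e ^+ 2); first exact: exprn_gt0.
by move=> y xye; apply: eB; rewrite -ball_normE/= eE hnorm_lt.
Qed.

Lemma cs_approx E x :
  (forall e, 0 < e -> exists2 y, cs_set E y & sq (x - y) < e) -> cs_set E x.
Proof.
move=> xE; apply: (@cs_closed _ _ E) => B /nbhs_sqnormP[e e0 eB].
by have [y Ey xye] := xE _ e0; exists y; split=> //; exact: eB.
Qed.

Lemma cs0 E : cs_set E 0. Proof. by case: (cs_linear E). Qed.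

Lemma csZ E a x : cs_set E x -> cs_set E (a *: x).
Proof.
by have [E0 El] := cs_linear E => Ex; have := El a _ _ Ex E0; rewrite addr0.
Qed.

Lemma csD E x y : cs_set E x -> cs_set E y -> cs_set E (x + y).
Proof.
by have [_ El] := cs_linear E => Ex Ey; have := El 1 _ _ Ex Ey; rewrite scale1r.
Qed.

Lemma csB E x y : cs_set E x -> cs_set E y -> cs_set E (x - y).
Proof. by move=> Ex Ey; rewrite -scaleN1r; apply: csD => //; exact: csZ. Qed.

Lemma closed_subspace_ext E F : (forall x, cs_set E x <-> cs_set F x) -> E = F.
Proof.
case: E F => [E El Ec] [F Fl Fc] /= EF.
have {}EF : E = F by apply/seteqP; split=> x; move/EF.
by subst F; congr ClosedSubspace; exact: Prop_irrelevance.
Qed.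

(** Completeness in the form used below: P d is the set of approximate solutions
with error d, and if these cluster as d decreases then they have a limit. It
avoids choosing sequences. *)
Lemma cauchy_family (P : R -> set H) :
  (forall d, 0 < d -> P d !=set0) ->
  (forall d d', d <= d' -> P d `<=` P d') ->
  (forall e, 0 < e -> exists2 d, 0 < d &
    forall x y, P d x -> P d y -> sq (x - y) < e) ->
  exists l, forall e d, 0 < e -> 0 < d -> exists2 x, P d x & sq (l - x) < e.
Proof.
move=> P0 Ple Pc; pose F := filter_from [set d : R | 0 < d] P.
have FF : ProperFilter F.
  apply: filter_from_proper P0; apply: filter_from_filter; first by exists 1 => /=.
  move=> d d' /= d0 d'0; exists (Num.min d d'); first by rewrite /= lt_min d0.
  by move=> x Px; split; apply: Ple Px; rewrite ge_min lexx ?orbT.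
have /cvg_ex[l Fl] : cvg F.
  apply: sqnorm_cauchy_cvg => e /Pc[d d0 dP].
  by have [x Px] := P0 _ d0; exists x, d => // y; exact: dP.
exists l => e d e0 d0.
have Fd : F (P d) by exists d.
by have [x [lxe Px]] := filter_ex (filterI (cvg_sqnorm _ Fl e0) Fd); exists x.
Qed.

Lemma parallelogram x y : sq (x + y) + sq (x - y) = 2 * sq x + 2 * sq y.
Proof. by rewrite sqD sqB; ring. Qed.

Lemma scaler_half_double x : (2^-1 : R)%:C%C *: (x + x) = x.
Proof.
rewrite -mulr2n -(scaler_nat 2 x) scalerA.
rewrite (_ : 2 = (2 : R)%:C%C) -?rmorphM ?mulVf ?scale1r ?pnatr_eq0//.
by rewrite rmorph_nat.
Qed.

(** Near-minimisers of the distance to x cluster by the parallelogram law, and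
their limit is the projection. Orthogonality is checked on the near-minimisers
themselves: moving y by a small multiple of u cannot decrease the squared
distance by more than d. *)
Lemma orth_proj_exists E x :
  exists y, cs_set E y /\ forall z, cs_set E z -> inner (x - y) z = 0.
Proof.
pose D := [set sq (x - y) | y in cs_set E].
have Dinf : has_inf D.
  split; first by exists (sq (x - 0)), 0 => //; exact: cs0.
  by exists 0 => _ [y _ <-]; exact: sq_ge0.
have ltD y : cs_set E y -> inf D <= sq (x - y).
  by move=> Ey; apply: inf_lbound; [case: Dinf|exists y].
have [l lP] : exists l, forall e d, 0 < e -> 0 < d ->
    exists2 y, cs_set E y /\ sq (x - y) < inf D + d & sq (l - y) < e.
  apply: (@cauchy_family (fun d => [set y | cs_set E y /\ sq (x - y) < inf D + d])).
  - move=> d d0; have [_ [y Ey <-] yd] := inf_adherent d0 Dinf.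
    by exists y.
  - by move=> d d' dd' y [Ey yd]; split=> //; apply: lt_le_trans yd _; rewrite lerD2l.
  - move=> e e0; exists (e / 4); first by rewrite divr_gt0.
    move=> y z [Ey yd] [Ez zd].
    have := ltD _ (csZ (2^-1)%:C%C (csD Ey Ez)).
    have -> : x - (2^-1)%:C%C *: (y + z)
        = (2^-1)%:C%C *: ((x - z) + (x - y)).
      rewrite -{1}(scaler_half_double x).
      by rewrite -scalerBr opprD addrACA [in LHS]addrC addrACA.
    rewrite sqZ; have := parallelogram (x - z) (x - y).
    have -> : x - z - (x - y) = y - z by rewrite opprB addrC addrA subrK.
    by move: yd zd; lra.
have El : cs_set E l.
  apply: cs_approx => e e0; have [y [Ey _] lye] := lP _ _ e0 ltr01.
  by exists y.
exists l; split=> // z Ez.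
have Rexl u : cs_set E u -> complex.Re (inner (x - l) u) = 0.
  move=> Eu; set r := complex.Re _; pose q := sq u + 1.
  have q0 : 0 < q by rewrite ltr_wpDl ?sq_ge0.
  suff : r ^+ 2 <= 0 by rewrite le_eqVlt ltNge sqr_ge0 orbF sqrf_eq0 => /eqP.
  apply/ler_addgt0Pr => e e0; rewrite add0r.
  (* With this d the bound 4 d q that will be obtained for r^2 is e. *)
  have d0 : 0 < e / (4 * q) by rewrite divr_gt0// mulr_gt0.
  set d := e / _ in d0.
  have [y [Ey yd] lyd] := lP _ _ d0 d0.
  pose s := complex.Re (inner (x - y) u).
  have sd : s ^+ 2 <= d * q.
    (* The step s / q would be optimal if q were the squared norm of u; the
       additional 1 in q keeps it defined for u = 0. *)
    have := ltD _ (csD Ey (csZ (s / q)%:C%C Eu)).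
    rewrite opprD addrA sqB sqZ linearZr_LR/=.
    rewrite (_ : complex.Re _ = s / q * s); last first.
      by rewrite /s; case: (inner (x - y) u) => a b /=; rewrite oppr0 mul0r subr0.
    have sq_q : (s / q) ^+ 2 * sq u <= s ^+ 2 / q.
      rewrite (_ : _ * _ = s ^+ 2 / q * (sq u / q)); last by field; rewrite gt_eqF.
      rewrite ler_piMr//; first by rewrite divr_ge0 ?sqr_ge0// ltW.
      by rewrite ler_pdivrMr// mul1r lerDl.
    rewrite (_ : s / q * s = s ^+ 2 / q); last by rewrite mulrAC -expr2.
    by rewrite -ler_pdivrMr//; move: sq_q yd; lra.
  have rd : (r - s) ^+ 2 <= d * q.
    have := inner_cauchy_schwarz (y - l) u.
    have -> : complex.Re (inner (y - l) u) = r - s.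
      by rewrite -raddfB -linearBl/= [in RHS]opprB [in RHS]addrC addrA subrK.
    move/le_trans; apply; rewrite sqBC ler_pM ?sq_ge0 ?ltW//.
    by rewrite ltr_pwDr.
  have -> : e = 4 * (d * q) by rewrite mulrA mulrAC mulrC divfK// gt_eqF// mulr_gt0.
  by move: sd rd; nra.
by apply: inner_eq0_re => a; apply: Rexl; exact: csZ.
Qed.

End hilbert_geometry.

(** * Orthogonal projections *)

(** An adjoint, of whatever nature, forces linearity; so operators below are bare
functions. *)
Lemma adjoint_linear {R : realType} (H K : hilbertType R) (J : H -> K) (Js : K -> H) :
  (forall x y, inner (J x) y = inner x (Js y)) -> linear J.
Proof.
move=> Jadj a x y; apply: inner_inj => z.
by rewrite Jadj linearPl/= [RHS]linearPl/= !Jadj.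
Qed.

Lemma adjointB {R : realType} (H K : hilbertType R) (J : H -> K) (Js : K -> H) :
  (forall x y, inner (J x) y = inner x (Js y)) -> {morph J : x y / x - y}.
Proof.
move=> Jadj x y; apply: inner_inj => z.
by rewrite Jadj linearBl/= [RHS]linearBl/= !Jadj.
Qed.

Section projections.
Context {R : realType} {H : hilbertType R}.
Implicit Types (x y z : H) (E K M N : closed_subspace H).

Lemma orth_proj_spec E x : cs_set E (orth_proj E x) /\
  forall z, cs_set E z -> inner (x - orth_proj E x) z = 0.
Proof. by have := xgetPex 0 (orth_proj_exists E x). Qed.

Lemma orth_proj_in E x : cs_set E (orth_proj E x).
Proof. by have [] := orth_proj_spec E x. Qed.

Lemma orth_projP E x z : cs_set E z -> inner (x - orth_proj E x) z = 0.
Proof. by have [_] := orth_proj_spec E x; exact. Qed.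

Lemma orth_proj_unique E x y : cs_set E y ->
  (forall z, cs_set E z -> inner (x - y) z = 0) -> orth_proj E x = y.
Proof.
move=> Ey xyE; have EP := orth_proj_in E x.
apply/eqP; rewrite -subr_eq0; apply/eqP/sq_eq0.
rewrite /sq /sqnorm; set w := _ - y; have Ew : cs_set E w by exact: csB.
suff -> : inner w w = 0 by [].
rewrite {1}/w (_ : _ - y = (x - y) - (x - orth_proj E x)).
  by rewrite linearBl/= xyE// orth_projP// subr0.
by rewrite opprB [RHS]addrC addrA subrK.
Qed.

Lemma orth_proj_id E x : cs_set E x -> orth_proj E x = x.
Proof.
by move=> Ex; apply: orth_proj_unique => // z _; rewrite subrr linear0l.
Qed.

Lemma orth_proj_inner E x z : cs_set E z -> inner (orth_proj E x) z = inner x z.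
Proof.
move=> Ez; apply/eqP; rewrite eq_sym -subr_eq0 -linearBl/=.
by rewrite orth_projP.
Qed.

Lemma orth_proj_sym E x y : inner (orth_proj E x) y = inner x (orth_proj E y).
Proof.
rewrite -[RHS](@orth_proj_inner E) ?[LHS]innerC; last exact: orth_proj_in.
by rewrite -(@orth_proj_inner E y) -?innerC//; exact: orth_proj_in.
Qed.

Lemma orth_proj_inner_self E x : inner (orth_proj E x) x = (sq (orth_proj E x))%:C%C.
Proof.
by rewrite orth_proj_sym -(@orth_proj_inner E x) ?innerxx//; exact: orth_proj_in.
Qed.

Lemma orth_projB E : {morph orth_proj E : x y / x - y}.
Proof. exact: (adjointB (orth_proj_sym E)). Qed.

Lemma orth_projC E x : orth_proj (orthocomplement E) x = x - orth_proj E x.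
Proof.
apply: orth_proj_unique => [z Ez|z Ez]; first exact: orth_projP.
by rewrite opprB addrC subrK; apply: inner_eq0C; apply: Ez; exact: orth_proj_in.
Qed.

Lemma orthocomplementK E : orthocomplement (orthocomplement E) = E.
Proof.
apply: closed_subspace_ext => x; split=> [Ex|Ex y /= yE]; last first.
  by apply: inner_eq0C; exact: yE.
have := orth_proj_id Ex; rewrite !orth_projC opprB addrC subrK => <-.
exact: orth_proj_in.
Qed.

Lemma sqnorm_proj E x : sq x = sq (orth_proj E x) + sq (x - orth_proj E x).
Proof.
have /pythagoras := orth_projP x (orth_proj_in E x).
by rewrite subrK addrC.
Qed.

Lemma sqnorm_proj_le E x : sq (orth_proj E x) <= sq x.
Proof. by rewrite (sqnorm_proj E x) lerDl sq_ge0. Qed.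

Lemma sqnorm_proj_id E x : sq x <= sq (orth_proj E x) -> cs_set E x.
Proof.
move=> h; suff /eqP : x - orth_proj E x = 0.
  by rewrite subr_eq0 => /eqP ->; exact: orth_proj_in.
apply: sq_eq0; have := sqnorm_proj E x.
by have := sq_ge0 (x - orth_proj E x); lra.
Qed.

(** The powers of a symmetric D with 0 <= D <= 1 converge strongly to the
projection onto the fixed vectors of D. The numbers a k = <D^k x, x> are
nonnegative and decrease with k, and
|D^n x - D^m x|^2 = a (2n) - 2 a (n + m) + a (2m), so the orbit of x is Cauchy;
the difference x - D^n x is orthogonal to every fixed vector. The hypothesis
|D x|^2 <= <D x, x> is D^2 <= D. *)
Lemma symmetric_contraction_cvg (D : H -> H) :
  (forall x y, inner (D x) y = inner x (D y)) ->
  (forall x, sq (D x) <= complex.Re (inner (D x) x)) ->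
  (forall x, complex.Re (inner (D x) x) <= sq x) ->
  forall x, exists l, [/\ D l = l, forall f, D f = f -> inner (x - l) f = 0 &
    forall e, 0 < e -> exists n0, forall n, (n0 <= n)%N -> sq (l - iter n D x) < e].
Proof.
move=> Dsym Dle Dle1 x.
have DB y z : D (y - z) = D y - D z by exact: (adjointB Dsym).
have Dcontr y : sq (D y) <= sq y by exact: le_trans (Dle y) (Dle1 y).
have iter_sym n m y z : inner (iter n D y) (iter m D z) = inner (iter (n + m) D y) z.
  elim: m n => [|m IH] n; first by rewrite addn0.
  by rewrite iterS -Dsym -iterS IH addSnnS.
pose a k := complex.Re (inner (iter k D x) x).
have aE n m : complex.Re (inner (iter n D x) (iter m D x)) = a (n + m)%N.
  by rewrite iter_sym.
have a_even i : a (i + i)%N = sq (iter i D x) by rewrite -aE.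
have a_odd i : a (i.+1 + i)%N = complex.Re (inner (D (iter i D x)) (iter i D x)).
  by rewrite -aE.
have parity k : exists i, k = (i + i)%N \/ k = (i.+1 + i)%N.
  exists k./2; rewrite addSn addnn -[in X in X = _](odd_double_half k).
  rewrite -[in X in _ \/ X = _](odd_double_half k).
  by case: (odd k); [right|left].
have a_ge0 k : 0 <= a k.
  have [i [->|->]] := parity k; first by rewrite a_even sq_ge0.
  by rewrite a_odd (le_trans _ (Dle _))// sq_ge0.
have a_decr k : a k.+1 <= a k.
  have [i [->|->]] := parity k; first by rewrite -addSn a_odd a_even; exact: Dle1.
  by rewrite -addnS a_odd a_even; exact: Dle.
have a_mono k j : a (k + j)%N <= a k.
  by elim: j => [|j IH]; rewrite ?addn0// addnS (le_trans (a_decr _)).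
have ainf : has_inf (range a).
  by split; [exists (a 0%N), 0%N|exists 0 => _ [k _ <-]].
set i0 := inf (range a).
have i0_le k : i0 <= a k by apply: inf_lbound; [case: ainf|exists k].
pose P d := [set y | exists2 n, y = iter n D x & a (n + n)%N < i0 + d].
have Pclose d y z : P d y -> P d z -> sq (y - z) < 2 * d.
  move=> [n -> nd] [m -> md]; rewrite sqB -!a_even aE.
  by have := i0_le (n + m)%N; move: nd md; lra.
have [l lP] : exists l, forall e d, 0 < e -> 0 < d -> exists2 y, P d y & sq (l - y) < e.
  apply: cauchy_family.
  - move=> d d0; have [_ [n _ <-] nd] := inf_adherent d0 ainf.
    by exists (iter n D x), n => //; exact: le_lt_trans (a_mono _ _) nd.
  - move=> d d' dd' y [n -> nd]; exists n => //.
    by apply: lt_le_trans nd _; rewrite lerD2l.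
  - move=> e e0; exists (e / 2); first by rewrite divr_gt0.
    by move=> y z Py Pz; have := Pclose _ _ _ Py Pz; lra.
have Dl : D l = l.
  apply/eqP; rewrite -subr_eq0; apply/eqP/sq_small => e e0.
  have d0 : 0 < e / 16 by rewrite divr_gt0.
  have [y Py ly] := lP _ _ d0 d0.
  have PDy : P (e / 16) (D y).
    case: Py => n -> nd; exists n.+1 => //.
    by apply: le_lt_trans nd; rewrite addnS addSn (le_trans (a_decr _)).
  have := Pclose _ _ _ PDy Py.
  have := sq_le_double (D l - D y) (D y - l).
  have := sq_le_double (D y - y) (y - l).
  rewrite !addrA !subrK -DB (sqBC y l); have := Dcontr (l - y).
  by move: ly; lra.
exists l; split=> // [f Df|e e0].
  apply: inner_eq0_approx => e e0; have [y Py ly] := lP _ _ e0 ltr01.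
  case: Py => n yE _.
  exists (x - y); last by rewrite opprB addrC addrA subrK sqBC.
  rewrite linearBl/= yE; apply/eqP; rewrite subr_eq0; apply/eqP.
  elim: n {yE ly} => // n IH; by rewrite iterS Dsym Df.
have [y [n0 yE _] lye] := lP _ _ e0 ltr01.
exists n0 => n /subnKC <-; elim: (n - n0)%N => [|k IH]; first by rewrite addn0 -yE.
by rewrite addnS iterS -Dl -DB; exact: le_lt_trans (Dcontr _) IH.
Qed.

End projections.

(** * Operators intertwining two tuples together with their adjoints *)

Section intertwiners.
Context {R : realType} {N : nat}.
Implicit Types A B C T : op_tuple R N.

(** Every passage to the limit under an unbounded operator below goes through this
form of closedness. *)
Lemma closed_op_graphP (H : hilbertType R) (A : partial_op H) :
  closed (op_graph A) <->
  forall u v, (forall e, 0 < e ->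
      exists x, [/\ dom A x, sq (u - x) < e & sq (v - app A x) < e]) ->
    dom A u /\ app A u = v.
Proof.
split=> [clA u v uv|h [u v] cluv].
  suff [/= Au ->] : op_graph A (u, v) by split.
  apply: clA => W /= [[U V]] /= [/nbhs_sqnormP[e e0 eU] /nbhs_sqnormP[d d0 dV]] UVW.
  have ed0 : 0 < Num.min e d by rewrite lt_min e0.
  have [x [Ax ux vx]] := uv _ ed0; exists (x, app A x); split=> //.
  apply: UVW; split=> /=.
    by apply: eU; apply: lt_le_trans ux _; rewrite ge_min lexx.
  by apply: dV; apply: lt_le_trans vx _; rewrite ge_min lexx orbT.
have [|Au <-] := h u v; last by split.
move=> e e0.
have /cluv[[x y] [/= [Ax yE] [/= ux vx]]] : nbhs (u, v)
    ([set x | sq (u - x) < e] `*` [set y | sq (v - y) < e]).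
  exists ([set x | sq (u - x) < e], [set y | sq (v - y) < e]) => //.
  by split; exact: nbhs_sqnorm.
by exists x; rewrite -yE.
Qed.

Definition intertwines A B (J : op_space A -> op_space B) : Prop :=
  forall j x, dom (A j) x ->
    dom (B j) (J x) /\ app (B j) (J x) = J (app (A j) x).

(** The morphisms of the theory. Requiring the adjoint to intertwine as well is
what makes ranges reducing, and not merely invariant. *)
Definition adj_intertwiner A B (J : op_space A -> op_space B)
    (Js : op_space B -> op_space A) : Prop :=
  [/\ forall x y, inner (J x) y = inner x (Js y), intertwines J & intertwines Js].

Lemma adj_intertwiner_sym A B (J : op_space A -> op_space B)
    (Js : op_space B -> op_space A) :
  adj_intertwiner J Js -> adj_intertwiner Js J.
Proof. by case=> Jadj JI JsI; split=> // x y; rewrite innerC -Jadj -innerC. Qed.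

Lemma adj_intertwiner_comp A B C (J : op_space A -> op_space B)
    (Js : op_space B -> op_space A) (L : op_space B -> op_space C)
    (Ls : op_space C -> op_space B) :
  adj_intertwiner J Js -> adj_intertwiner L Ls ->
  adj_intertwiner (L \o J) (Js \o Ls).
Proof.
move=> [Jadj JI JsI] [Ladj LI LsI]; split=> [x y|j x Ax|j x Cx] /=.
- by rewrite Ladj Jadj.
- have [BJ <-] := JI _ _ Ax; exact: LI.
- have [BL <-] := LsI _ _ Cx; exact: JsI.
Qed.

Lemma red_intertwiner T E : red T E ->
  @adj_intertwiner T T (orth_proj E) (orth_proj E).
Proof. by move=> TE; split=> // x y; exact: orth_proj_sym. Qed.

(** The adjoint of the inclusion of E. *)
Definition sub_proj (H : hilbertType R) (E : closed_subspace H) (x : H) :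
    subspace_type E :=
  SubspaceVec (asboolT (orth_proj_in E x) : orth_proj E x \in cs_mem E).

Lemma sub_valP (H : hilbertType R) (E : closed_subspace H) (x : subspace_type E) :
  cs_set E (sub_val x).
Proof. by case: x => x /= /asboolP. Qed.

Lemma sub_projK (H : hilbertType R) (E : closed_subspace H) :
  cancel (@sub_val R H E) (sub_proj E).
Proof. by move=> x; apply: val_inj; apply: orth_proj_id; exact: sub_valP. Qed.

Lemma sub_val_adj (H : hilbertType R) (E : closed_subspace H)
    (x : subspace_type E) (y : H) :
  inner (sub_val x) y = inner x (sub_proj E y).
Proof.
change (inner (sub_val x) y = inner (sub_val x) (orth_proj E y)).
by rewrite -orth_proj_sym (orth_proj_id (sub_valP x)).
Qed.

Lemma sq_sub_valB (H : hilbertType R) (E : closed_subspace H)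
    (x y : subspace_type E) : sq (sub_val x - sub_val y) = sq (x - y).
Proof. by rewrite -(adjointB (@sub_val_adj H E)). Qed.

Lemma sub_val_app T E j (x : op_space (restr T E)) : red T E ->
  dom (restr T E j) x -> sub_val (app (restr T E j) x) = app (T j) (sub_val x).
Proof.
move=> TE /= Tx; rewrite (@val_insubd _ _ (subspace_type E)).
suff -> : app (T j) (sub_val x) \in cs_mem E by [].
apply/asboolP; have [_] := TE j _ Tx; rewrite (orth_proj_id (sub_valP x)) => ->.
exact: orth_proj_in.
Qed.

Lemma sub_val_intertwiner T E : red T E ->
  @adj_intertwiner (restr T E) T (@sub_val R _ E) (sub_proj E).
Proof.
move=> TE; split=> [x y|j x Tx|j x Tx].
- exact: sub_val_adj.
- by split=> //; rewrite sub_val_app.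
- have [TPx TP] := TE j _ Tx; split=> //.
  by apply: val_inj; rewrite [LHS]sub_val_app.
Qed.

Lemma CDD_restr T E : CDD T -> red T E -> CDD (restr T E).
Proof.
move=> TC TE j; have [Tlin Tclo Tden] := TC j; split.
- split=> [|a x y Tx Ty]; first by case: Tlin.
  have [_ /(_ a _ _ Tx Ty)[Taxy Taxy']] := Tlin.
  split=> //; apply: val_inj; rewrite [LHS]sub_val_app//.
  apply: (etrans Taxy'); by rewrite -!sub_val_app.
- apply/closed_op_graphP => u v uv.
  have [|Tu Tuv] := (closed_op_graphP (T j)).1 Tclo (sub_val u) (sub_val v).
    move=> e /uv[x [Tx ux vx]]; exists (sub_val x); split=> //.
    by rewrite -sub_val_app// sq_sub_valB.
  by split=> //; apply: val_inj; rewrite [LHS]sub_val_app.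
- move=> O [x Ox] openO.
  have /nbhs_sqnormP[e e0 eO] : nbhs x O by apply: open_nbhs_nbhs; split.
  have [y [/= xy Ty]] : [set y | sq (sub_val x - y) < e] `&` dom (T j) !=set0.
    have [y [/= /interior_subset xy Ty]] :
        [set y | sq (sub_val x - y) < e]^° `&` dom (T j) !=set0.
      apply: Tden; last exact: open_interior.
      by exists (sub_val x); exact: nbhs_sqnorm.
    by exists y.
  exists (sub_proj E y); split; last by have [] := TE j _ Ty.
  apply: eO; apply: le_lt_trans xy; rewrite -sq_sub_valB.
  by rewrite -[in leLHS](orth_proj_id (sub_valP x)) -orth_projB sqnorm_proj_le.
Qed.

(** Unitary equivalence is isomorphism in the category of these morphisms: the
equality of domains contained in it says that the inverse intertwines too. *)
Lemma unitarily_equivalentP A B :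
  unitarily_equivalent A B <->
  exists J Js, [/\ @adj_intertwiner A B J Js, cancel J Js & cancel Js J].
Proof.
split=> [[U [[[Us UK UsK] Uinner]] Udom]|[J [Js [[Jadj JI JsI] JK JsK]]]].
  exists U, Us; split=> //; split=> [x y|j x Ax|j x Bx].
  - by rewrite -{1}(UsK y) Uinner.
  - by have [domU appU] := Udom j; rewrite appU//; split=> //; move: Ax; rewrite domU.
  - have [domU appU] := Udom j.
    have Ax : dom (A j) (Us x) by rewrite domU /preimage/= UsK.
    by split=> //; apply: (can_inj UK); rewrite appU// !UsK.
have Jlin := adjoint_linear Jadj.
pose isL := GRing.isLinear.Build R[i] (op_space A) (op_space B) *:%R J Jlin.
pose U : {linear op_space A -> op_space B} := HB.pack J isL.
exists U; split; first split; first by exists Js.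
  by move=> x y; rewrite Jadj JK.
move=> j; split=> [|x /JI[]//]; apply/seteqP; split=> x /=; first by case/JI.
by case/JsI; rewrite JK.
Qed.

Lemma unitarily_equivalent_sym A B :
  unitarily_equivalent A B -> unitarily_equivalent B A.
Proof.
move=> /unitarily_equivalentP[J [Js [JI JK JsK]]]; apply/unitarily_equivalentP.
by exists Js, J; split=> //; exact: adj_intertwiner_sym.
Qed.

(** J Js is the projection onto the range of J: it fixes the range, and
y - J (Js y) is orthogonal to it because Js kills that vector. Being the
composite of two intertwiners, it commutes with the operators of B. *)
Lemma isometry_range A B (J : op_space A -> op_space B) Js :
  adj_intertwiner J Js -> cancel J Js ->
  exists E, [/\ forall y, cs_set E y <-> exists x, J x = y, red B E &
    unitarily_equivalent A (restr B E)].
Proof.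
move=> JI JK; have [Jadj JB JsA] := JI.
have Jsadj : forall x y, inner (Js x) y = inner x (J y).
  by case: (adj_intertwiner_sym JI).
pose S : set (op_space B) := [set y | exists x, J x = y].
have Slin : S 0 /\ forall (a : R[i]) x y, S x -> S y -> S (a *: x + y).
  split; first by exists 0; have := adjointB Jadj 0 0; rewrite !subrr.
  by move=> a _ _ [x <-] [y <-]; exists (a *: x + y); rewrite (adjoint_linear Jadj).
have S_perp y z : S z -> inner (y - J (Js y)) z = 0.
  by case=> x <-; rewrite -Jsadj (adjointB Jsadj) JK subrr linear0l.
have Sclo : closed S.
  move=> y clSy; exists (Js y); apply/esym/eqP; rewrite -subr_eq0; apply/eqP.
  set z := y - _; have zS w : S w -> inner w z = 0.
    by move=> Sw; apply: inner_eq0C; exact: S_perp.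
  apply: sq_eq0; suff : inner z z = 0 by rewrite innerxx => -[].
  rewrite {1}/z linearBl/= (zS (J _)); last by exists (Js y).
  rewrite subr0; apply: inner_eq0_approx => e e0.
  have [w [Sw yw]] := clSy _ (nbhs_sqnorm y e0).
  by exists w => //; exact: zS.
have [E ES] : exists E : closed_subspace (op_space B), cs_set E = S.
  by exists (ClosedSubspace Slin Sclo).
have EJ x : cs_set E (J x) by rewrite ES; exists x.
have EP y : orth_proj E y = J (Js y).
  by apply: orth_proj_unique => // z; rewrite ES; exact: S_perp.
have BE : red B E.
  by move=> j y By; rewrite !EP; have [AJ <-] := JsA _ _ By; exact: JB.
exists E; split=> //; first by move=> y; rewrite ES.
apply/unitarily_equivalentP.
exists (sub_proj E \o J), (Js \o @sub_val _ _ E); split.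
- apply: adj_intertwiner_comp JI _; apply: adj_intertwiner_sym.
  exact: sub_val_intertwiner.
- by move=> x /=; rewrite orth_proj_id.
- move=> y; apply: val_inj => /=; rewrite EP JK -EP orth_proj_id//.
  exact: sub_valP.
Qed.

End intertwiners.

(** * Isometric families into members of an ideal *)

Section hilbert_sum_truncation.
Context {R : realType} {S : choiceType} (H : S -> hilbertType R).
Implicit Types (y z : hilbert_sum H) (F : {fset S}).

Lemma hsum_norm_ge y F : partial_sum (fun s => sq (hcoord y s)) F <= sq y.
Proof. exact: hsum_sqnorm_ub. Qed.

Lemma hsum_norm_approx y e : 0 < e ->
  exists F, sq y - e < partial_sum (fun s => sq (hcoord y s)) F.
Proof.
move=> e0; apply: contrapT => /forallNP ltF.
have : sq y <= sq y - e.
  by apply: hsum_sqnorm_le => F; rewrite leNgt; apply/negP; exact: ltF.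
by rewrite lerBrDr gerDl leNgt e0.
Qed.

Lemma truncation_summable y F :
  square_summable (fun s => if s \in F then hcoord y s else 0).
Proof.
have [M yM] := (square_summableP _).1 (hcoordP y).
apply/square_summableP; exists M => G; apply: le_trans (yM G).
rewrite !partial_sumE ler_sum// => s _; case: ifP => // _.
by rewrite -/(sq _) sq0 sq_ge0.
Qed.

(** Truncations approximate an element of the sum, and on them the adjoint of a
map into the sum is a finite sum of the adjoints of its components. *)
Definition truncation F y : hilbert_sum H := HilbertSum (truncation_summable y F).

Lemma sq_truncation y F :
  sq (y - truncation F y) <= sq y - partial_sum (fun s => sq (hcoord y s)) F.
Proof.
apply: hsum_sqnorm_le => G; rewrite lerBrDr.
(* |y|^2 on the union of F and G splits into the parts b on F and a off F. *)
pose a s := if s \in F then 0 else sq (hcoord y s).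
pose b s := if s \in F then sq (hcoord y s) else 0.
have a0 s : 0 <= a s by rewrite /a; case: ifP => // _; exact: sq_ge0.
have b0 s : 0 <= b s by rewrite /b; case: ifP => // _; exact: sq_ge0.
rewrite (_ : partial_sum _ G = partial_sum a G); last first.
  rewrite !partial_sumE; apply: eq_bigr => s _; rewrite hcoordB /a /=.
  by case: ifP => _; rewrite ?subrr ?subr0// -/(sq _) sq0.
rewrite (_ : partial_sum _ F = partial_sum b F); last first.
  rewrite !partial_sumE big_seq [RHS]big_seq.
  by apply: eq_bigr => s sF; rewrite /b sF.
apply: (@le_trans _ _ (partial_sum a (G `|` F)%fset + partial_sum b (G `|` F)%fset)).
  by rewrite lerD// partial_sum_le// ?fsubsetUl ?fsubsetUr.
apply: le_trans (hsum_norm_ge y (G `|` F)%fset).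
rewrite !partial_sumE -big_split/= ler_sum// => s _; rewrite /a /b.
by case: ifP => _; rewrite ?add0r ?addr0.
Qed.

Lemma inner_truncation y z F :
  inner (truncation F y) z = \sum_(s <- F) inner (hcoord y s) (hcoord z s).
Proof.
apply: hsum_innerE; apply: cvg_near_cst; first exact: totally_filter.
exists F => // G /= FG; rewrite partial_sumE.
rewrite (big_fsetID _ [in F] G)/= [X in _ + X]big_seq [X in _ + X]big1 ?addr0.
  have -> : [fset s in G | s \in F]%fset = F.
    apply/fsetP => s; rewrite !inE andbC; case: (boolP (s \in F)) => // sF.
    by move/fsubsetP : FG => ->.
  by rewrite big_seq [RHS]big_seq; apply: eq_bigr => s ->.
by move=> s; rewrite !inE/= => /andP[_ /negPf ->]; exact: linear0l.
Qed.

End hilbert_sum_truncation.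

Section isometric_family.
Context {R : realType} {N : nat}.

Lemma linear_op_sum (H : hilbertType R) (A : partial_op H) (S : choiceType)
    (F : {fset S}) (x : S -> H) :
  linear_op A -> (forall s, dom A (x s)) ->
  dom A (\sum_(s <- F) x s) /\
  app A (\sum_(s <- F) x s) = \sum_(s <- F) app A (x s).
Proof.
move=> [A0 Alin] Ax.
have appA0 : app A 0 = 0.
  have [_ h] := Alin (-1) 0 0 A0 A0.
  by move: h; rewrite scaler0 addr0 scaleN1r addNr.
apply: (big_ind2 (fun u v => dom A u /\ app A u = v)) => //.
move=> u u' v v' [Au <-] [Av <-]; have := Alin 1 _ _ Au Av.
by rewrite !scale1r.
Qed.

Variables (calA : op_tuple R N -> Prop) (hI : ideal calA).
Variables (A : op_tuple R N) (CA : CDD A).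
Variables (S : choiceType) (B : S -> op_tuple R N).
Variables (C : forall s, op_space A -> op_space (B s)).
Variables (Cs : forall s, op_space (B s) -> op_space A).
Arguments C : clear implicits.
Arguments Cs : clear implicits.
Hypothesis CI : forall s, adj_intertwiner (C s) (Cs s).
Hypothesis Cle : forall x F, partial_sum (fun s => sq (C s x)) F <= sq x.
Hypothesis Capprox : forall x e, 0 < e ->
  exists F, sq x - e < partial_sum (fun s => sq (C s x)) F.

Let Cadj s x y : inner (C s x) y = inner x (Cs s y).
Proof. by case: (CI s). Qed.

Let C_summable x : square_summable (fun s => C s x).
Proof. by apply/square_summableP; exists (sq x) => F; exact: Cle. Qed.

Let V x : op_space (direct_sum B) := HilbertSum (C_summable x).

Let V_linear : linear V.
Proof.
by move=> a x y; apply: hsum_eq => s /=; rewrite (adjoint_linear (@Cadj s)).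
Qed.

Let V_sq x : sq (V x) = sq x.
Proof.
apply/eqP; rewrite eq_le; apply/andP; split.
  by apply: hsum_sqnorm_le => F; exact: Cle.
apply/ler_addgt0Pr => e /(Capprox x)[F xF]; rewrite -lerBlDr.
by apply: le_trans (ltW xF) _; exact: (hsum_norm_ge (V x) F).
Qed.

Let VB x y : V (x - y) = V x - V y.
Proof.
by rewrite [x - y]addrC -scaleN1r V_linear scaleN1r addrC.
Qed.

Let V_inner x y : inner (V x) (V y) = inner x y.
Proof.
rewrite (polarization inner (V x)) [RHS](polarization inner x).
rewrite -!/(sq _) addrC [RHS]addrC.
have VD z : V x + V z = V (x + z).
  by have := V_linear 1 x z; rewrite !scale1r => ->.
have VZ a z : a *: V z = V (a *: z).
  have V0 : V 0 = 0 by rewrite -[0](subrr 0) VB subrr.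
  by have := V_linear a z 0; rewrite V0 !addr0.
by rewrite !VZ !VD !V_sq.
Qed.

Let V_range_closed : closed [set y | exists x, V x = y].
Proof.
move=> y cly.
have [l lP] : exists l, forall e d, 0 < e -> 0 < d ->
    exists2 x, sq (y - V x) < d & sq (l - x) < e.
  apply: (@cauchy_family _ _ (fun d => [set x | sq (y - V x) < d])).
  - by move=> d d0; have [_ [[x <-] yx]] := cly _ (nbhs_sqnorm y d0); exists x.
  - by move=> d d' dd' x /= xd; exact: lt_le_trans xd dd'.
  - move=> e e0; exists (e / 4) => [|x z /= xd zd]; first by rewrite divr_gt0.
    have := sq_le_double (V x - y) (y - V z).
    by rewrite addrA subrK -VB V_sq (sqBC (V x)); lra.
exists l; apply/eqP; rewrite -subr_eq0; apply/eqP/sq_small => e e0.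
have e4 : 0 < e / 4 by rewrite divr_gt0.
have [x yx lx] := lP _ _ e4 e4.
have := sq_le_double (V l - V x) (V x - y).
by rewrite addrA subrK -VB V_sq (sqBC (V x)); lra.
Qed.

(** Vs y is the preimage of the projection of y onto the range of V, which is
closed because V is isometric. *)
Let V_adjoint : exists Vs,
  (forall x y, inner (V x) y = inner x (Vs y)) /\ cancel V Vs.
Proof.
have Slin : [set y | exists x, V x = y] 0 /\ forall (a : R[i]) y z,
    [set y | exists x, V x = y] y -> [set y | exists x, V x = y] z ->
    [set y | exists x, V x = y] (a *: y + z).
  split; first by exists 0; rewrite -[0](subrr 0) VB subrr.
  by move=> a _ _ [x <-] [y <-]; exists (a *: x + y); rewrite V_linear.
pose M := ClosedSubspace Slin V_range_closed.
pose Vs y := projT1 (cid (orth_proj_in M y)).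
have VVs y : V (Vs y) = orth_proj M y by exact: projT2 (cid (orth_proj_in M y)).
have PV x : orth_proj M (V x) = V x by apply: orth_proj_id; exists x.
exists Vs; split=> [x y|x].
  by rewrite -[RHS]V_inner VVs -orth_proj_sym PV.
apply/eqP; rewrite -subr_eq0; apply/eqP/sq_eq0.
by rewrite -V_sq VB VVs PV subrr sq0.
Qed.

(** The map V gathering the C s is an isometry into the direct sum of the B s, and
it intertwines because each C s does. For its adjoint Vs this is seen on
truncations of y, where Vs is a finite sum of the Cs s; the operators of A are
closed and Vs is a contraction, so it passes to the limit. Then the range of V is
reducing, and A is equivalent to a reducing part of a member of the ideal. *)
Lemma ideal_isometric_family :
  inhabited S -> (forall s, calA (B s)) -> calA A.
Proof.
move=> S0 calB.
have [Vs [Vadj VK]] := V_adjoint.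
have calS : calA (direct_sum B) by exact: (ideal_direct_sum hI).
have Vsadj x y : inner (Vs x) y = inner x (V y).
  by rewrite innerC -Vadj -innerC.
have VsB := adjointB Vsadj.
have Vs_sq y : sq (Vs y) <= sq y.
  have := sq_ge0 (y - V (Vs y)).
  by rewrite sqB V_sq -Vsadj innerxx/=; lra.
have VI : @adj_intertwiner R N A (direct_sum B) V Vs.
  split=> // [j x Ax|j y].
    have CB s := (let: And3 _ h _ := CI s in h) j x Ax.
    have appC : (fun s => app (B s j) (C s x)) = fun s => C s (app (A j) x).
      by apply: functional_extensionality_dep => s; have [] := CB s.
    have sC : square_summable (fun s => app (B s j) (C s x)).
      by rewrite appC; exact: C_summable.
    split; first by split=> // s; have [] := CB s.
    rewrite /=; case: pselect => // sC'; apply: hsum_eq => s /=.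
    by have [] := CB s.
  case=> By sBy.
  have [Alin Aclo _] := CA j.
  have appy : app (direct_sum B j) y = HilbertSum sBy.
    by rewrite /=; case: pselect => // sBy'; congr HilbertSum; exact: Prop_irrelevance.
  rewrite appy; apply: (closed_op_graphP (A j)).1 => // e e0.
  have Vs_trunc F z : Vs (truncation F z) = \sum_(s <- F) Cs s (hcoord z s).
    apply: inner_inj => w; rewrite Vsadj inner_truncation linear_sumlz.
    by apply: eq_bigr => s _ /=; rewrite innerC Cadj -innerC.
  have Vs_close z F : sq z - e < partial_sum (fun s => sq (hcoord z s)) F ->
      sq (Vs z - \sum_(s <- F) Cs s (hcoord z s)) < e.
    rewrite -Vs_trunc -VsB => zF; apply: le_lt_trans (Vs_sq _) _.
    by apply: le_lt_trans (sq_truncation _ _) _; move: zF; lra.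
  (* Both the truncation of y and that of its image must be close, hence a common
     F for the two. *)
  have [F1 yF] := hsum_norm_approx y e0.
  have [F2 ByF] := hsum_norm_approx (HilbertSum sBy) e0.
  pose F := (F1 `|` F2)%fset.
  have CsI s := let: And3 _ _ h := CI s in h j _ (By s).
  have [Asum appsum] := linear_op_sum F Alin (fun s => (CsI s).1).
  exists (\sum_(s <- F) Cs s (hcoord y s)); split=> //.
    apply: Vs_close; apply: lt_le_trans yF _.
    by apply: partial_sum_le; rewrite ?fsubsetUl// => s; exact: sq_ge0.
  rewrite appsum (eq_bigr (fun s => Cs s (hcoord (HilbertSum sBy) s))); last first.
    by move=> s _ /=; have [] := CsI s.
  apply: Vs_close; apply: lt_le_trans ByF _.
  by apply: partial_sum_le; rewrite ?fsubsetUr// => s; exact: sq_ge0.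
have [E [_ rE eqE]] := isometry_range VI VK.
apply: (ideal_equivalent hI) CA _; first exact: (ideal_restrict hI) calS rE.
exact: unitarily_equivalent_sym.
Qed.

End isometric_family.

(** * Alternating projections and the lattice of reducing subspaces *)

Section intersection.
Context {R : realType} {H : hilbertType R}.
Implicit Types (M K : closed_subspace H) (x : H).

Lemma inter_linear M K : let S := cs_set M `&` cs_set K in
  S 0 /\ forall (a : R[i]) x y, S x -> S y -> S (a *: x + y).
Proof.
split=> [|a x y [Mx Kx] [My Ky]]; first by split; exact: cs0.
by split; apply: csD => //; exact: csZ.
Qed.

Definition cs_inter M K : closed_subspace H :=
  ClosedSubspace (inter_linear M K) (closedI (@cs_closed _ _ M) (@cs_closed _ _ K)).

Definition compression M K x := orth_proj M (orth_proj K (orth_proj M x)).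

(** Von Neumann's theorem: a vector fixed by the compression loses no norm under
the projection onto K, so it lies in both subspaces. *)
Lemma alternating_projections M K x e : 0 < e ->
  exists n0, forall n, (n0 <= n)%N ->
    sq (orth_proj (cs_inter M K) x - iter n (compression M K) x) < e.
Proof.
set D := compression M K => e0.
have Dsym y z : inner (D y) z = inner y (D z).
  by rewrite /D /compression !orth_proj_sym.
have reD y : complex.Re (inner (D y) y) = sq (orth_proj K (orth_proj M y)).
  by rewrite /D /compression orth_proj_sym orth_proj_inner_self.
have [|y|y|l [Dl lfix lcvg]] := @symmetric_contraction_cvg _ _ D _ _ _ x.
- exact: Dsym.
- by rewrite reD; exact: sqnorm_proj_le.
- by rewrite reD; apply: le_trans (sqnorm_proj_le _ _) (sqnorm_proj_le _ _).
have Ml : cs_set M l by rewrite -Dl; exact: orth_proj_in.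
have Kl : cs_set K l.
  apply: sqnorm_proj_id; rewrite -{1}Dl /D /compression (orth_proj_id Ml).
  exact: sqnorm_proj_le.
have -> : orth_proj (cs_inter M K) x = l.
  apply: orth_proj_unique => // f [Mf Kf]; apply: lfix.
  by rewrite /D /compression !(orth_proj_id Mf, orth_proj_id Kf).
exact: lcvg.
Qed.

End intersection.

Section reducing_lattice.
Context {R : realType} {N : nat}.
Variables (T : op_tuple R N) (CT : CDD T).
Implicit Types (E K M : closed_subspace (op_space T)).

Lemma red_compl E : red T E -> red T (orthocomplement E).
Proof.
move=> TE j x Tx; rewrite !orth_projC; have [[_ Tlin] _ _] := CT j.
have [TPx PTx] := TE j _ Tx; have := Tlin (-1) _ _ TPx Tx.
by rewrite !scaleN1r ![- _ + _]addrC PTx.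
Qed.

Lemma iter_intertwiner (D : op_space T -> op_space T) n :
  @intertwines R N T T D -> @intertwines R N T T (iter n D).
Proof.
move=> DT j x Tx; elim: n => [|n [IH1 IH2]] //=.
by have [] := DT _ _ IH1; rewrite IH2.
Qed.

(** The projection onto the intersection is a strong limit of polynomials in two
projections that commute with T. *)
Lemma red_inter M K : red T M -> red T K -> red T (cs_inter M K).
Proof.
move=> TM TK j x Tx; have [_ Tclo _] := CT j.
apply: (closed_op_graphP (T j)).1 => // e e0.
have [n1 xn] := alternating_projections M K x e0.
have [n2 Txn] := alternating_projections M K (app (T j) x) e0.
have DT : @intertwines R N T T (compression M K).
  move=> i y Ty; have [Ty1 E1] := TM i _ Ty; have [Ty2 E2] := TK i _ Ty1.
  by have [Ty3 E3] := TM i _ Ty2; rewrite /compression E3 E2 E1.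
have [Tn appn] := iter_intertwiner (maxn n1 n2) DT Tx.
exists (iter (maxn n1 n2) (compression M K) x); split=> //.
  by apply: xn; exact: leq_maxl.
by rewrite appn; apply: Txn; exact: leq_maxr.
Qed.

End reducing_lattice.

Section peeling.
Context {R : realType} {H : hilbertType R} (E K : closed_subspace H).

(** The remainder of x after n peelings, alternately off K and off E. *)
Fixpoint peel n (x : H) : H := if n is n'.+1 then
  orth_proj (orthocomplement (if odd n' then E else K)) (peel n' x) else x.

Let G n := if odd n then E else K.

Lemma sq_peel n x : sq (peel n x) = sq (orth_proj (G n) (peel n x)) + sq (peel n.+1 x).
Proof. by rewrite /= orth_projC; exact: sqnorm_proj. Qed.

Lemma sq_peel_sum n x :
  \sum_(i < n) sq (orth_proj (G i) (peel i x)) = sq x - sq (peel n x).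
Proof.
elim: n => [|n IH]; first by rewrite big_ord0 subrr.
by rewrite big_ord_recr/= IH [in sq (peel n x)]sq_peel /=; ring.
Qed.

Lemma peel_double n x : cs_set (orthocomplement E) x ->
  peel n.*2 x = iter n (compression (orthocomplement E) (orthocomplement K)) x.
Proof.
move=> Ex; have En m : cs_set (orthocomplement E) (peel m.*2 x).
  by case: m => [|m] //; rewrite doubleS [peel _.+2 _]/= odd_double; exact: orth_proj_in.
elim: n => // n IH; rewrite doubleS iterS -IH /= odd_double /compression.
by rewrite (orth_proj_id (En n)).
Qed.

(** A finite set of indices lies in an initial segment, where the sum telescopes. *)
Lemma peel_partial_sum_le x (F : {fset nat}) :
  partial_sum (fun n => sq (orth_proj (G n) (peel n x))) F <= sq x.
Proof.
pose n := (\max_(i <- F) i).+1.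
apply: (@le_trans _ _ (\sum_(i < n) sq (orth_proj (G i) (peel i x)))).
  have FP : perm_eq F [seq i <- index_iota 0 n | i \in F].
    apply: uniq_perm; rewrite ?fset_uniq ?filter_uniq ?iota_uniq// => i.
    rewrite mem_filter mem_index_iota /=; case: (boolP (i \in F)) => //= iF.
    by rewrite ltnS (leq_bigmax_seq i).
  rewrite partial_sumE (perm_big _ FP) big_filter big_mkcond.
  rewrite (_ : \sum_(i < n) _ = \sum_(0 <= i < n) sq (orth_proj (G i) (peel i x))).
    by apply: ler_sum => i _; case: ifP => // _; exact: sq_ge0.
  by rewrite big_mkord.
by rewrite sq_peel_sum gerBl sq_ge0.
Qed.

(** On such x the remainders tend to 0, so that nothing of |x|^2 is lost. *)
Lemma peel_cvg x e : 0 < e -> cs_set (orthocomplement E) x ->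
  (forall y, cs_set (cs_inter (orthocomplement E) (orthocomplement K)) y ->
     inner x y = 0) ->
  exists F, sq x - e < partial_sum (fun n => sq (orth_proj (G n) (peel n x))) F.
Proof.
move=> e0 Ex x_perp.
have [n0 xn] :=
  alternating_projections (orthocomplement E) (orthocomplement K) x e0.
have Px0 : orth_proj (cs_inter (orthocomplement E) (orthocomplement K)) x = 0.
  by apply: orth_proj_unique => [|z Ez]; [exact: cs0|rewrite subr0 x_perp].
exists [fset i | i in iota 0 n0.*2]%fset.
rewrite partial_sumE (perm_big (index_iota 0 n0.*2)).
  rewrite big_mkord sq_peel_sum ltrD2l ltrN2 peel_double//.
  by have := xn _ (leqnn n0); rewrite Px0 sub0r sqN.
apply: uniq_perm; rewrite ?fset_uniq ?iota_uniq// => i.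
by rewrite !inE /index_iota subn0.
Qed.

End peeling.

(** * Orthogonal families of subspaces *)

Section orthogonal_family.
Context {R : realType} {H : hilbertType R}.
Variables (S : choiceType) (K : S -> closed_subspace H).
Hypothesis K_orth : forall s t, s <> t ->
  forall x y, cs_set (K s) x -> cs_set (K t) y -> inner x y = 0.
Implicit Types (F : {fset S}) (x y : H).

Let u F x := \sum_(s <- F) orth_proj (K s) x.

Let bsum F x := partial_sum (fun s => sq (orth_proj (K s) x)) F.

Let inner_u F x y : inner (x - u F x) y = inner x (y - u F y).
Proof.
rewrite linearBl linearBr /=; congr (_ - _).
rewrite linear_sumlz linear_sumr; apply: eq_bigr => s _ /=.
exact: orth_proj_sym.
Qed.

Let sq_remainder F x : sq (x - u F x) = sq x - bsum F x.
Proof.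
have xu : complex.Re (inner x (u F x)) = bsum F x.
  rewrite linear_sumr raddf_sum /bsum partial_sumE; apply: eq_bigr => s _ /=.
  by rewrite -orth_proj_sym orth_proj_inner_self.
suff uu : sq (u F x) = bsum F x by rewrite sqB xu uu; ring.
rewrite -xu -[LHS]/(complex.Re (inner (u F x) (u F x))); congr complex.Re.
rewrite {1}/u linear_sumlz [RHS]linear_sumr big_seq [RHS]big_seq.
apply: eq_bigr => s sF /=; rewrite linear_sumr (bigD1_seq s) ?fset_uniq//=.
rewrite big1 ?addr0 => [|t ts]; last first.
  apply: K_orth (orth_proj_in _ _) (orth_proj_in _ _).
  by apply/eqP; rewrite eq_sym.
by rewrite orth_proj_inner//; exact: orth_proj_in.
Qed.

Let S_mono F G x : (F `<=` G)%fset -> bsum F x <= bsum G x.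
Proof. by move=> FG; apply: partial_sum_le => // s; exact: sq_ge0. Qed.

Lemma bessel F x : partial_sum (fun s => sq (orth_proj (K s) x)) F <= sq x.
Proof. by rewrite -subr_ge0 -sq_remainder sq_ge0. Qed.

(** The vectors that are limits of their partial sums of projections form a closed
subspace, since x - u F x is linear and contractive in x and gets smaller as F
grows; it contains every K s. *)
Lemma span_approx x e : cs_set (closed_span (range K)) x -> 0 < e ->
  exists F, sq (x - \sum_(s <- F) orth_proj (K s) x) < e.
Proof.
pose L := [set x | forall e, 0 < e -> exists F, sq (x - u F x) < e].
have Llin : L 0 /\ forall (a : R[i]) x y, L x -> L y -> L (a *: x + y).
  split=> [d d0|a y z Ly Lz d d0].
    by exists fset0; rewrite sq_remainder /bsum partial_sumE big_seq_fset0 sq0 subr0.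
  pose b := complex.Re a ^+ 2 + complex.Im a ^+ 2.
  have b0 : 0 <= b by rewrite addr_ge0 ?sqr_ge0.
  have b1 : 0 < 4 * b + 1 by lra.
  have [F yF] := Ly _ (divr_gt0 d0 b1).
  have d4 : 0 < d / 4 by rewrite divr_gt0.
  have [G zG] := Lz _ d4.
  exists (F `|` G)%fset; rewrite (adjoint_linear (inner_u _)).
  apply: le_lt_trans (sq_le_double _ _) _; rewrite sqZ_complex -/b.
  have {}yF : sq (y - u (F `|` G)%fset y) < d / (4 * b + 1).
    by apply: le_lt_trans yF; rewrite !sq_remainder lerD2l lerN2 S_mono ?fsubsetUl.
  have {}zG : sq (z - u (F `|` G)%fset z) < d / 4.
    by apply: le_lt_trans zG; rewrite !sq_remainder lerD2l lerN2 S_mono ?fsubsetUr.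
  have : 2 * (b * sq (y - u (F `|` G)%fset y)) <= d / 2.
    move: yF; rewrite ltr_pdivlMr//; move: (sq_ge0 (y - u (F `|` G)%fset y)); nra.
  by move: zG; lra.
have Lclo : closed L.
  move=> y cly d d0; have d4 : 0 < d / 4 by rewrite divr_gt0.
  have [z [Lz yz]] := cly _ (nbhs_sqnorm y d4); have [F zF] := Lz _ d4.
  exists F; have -> : y - u F y = ((y - z) - u F (y - z)) + (z - u F z).
    by rewrite (adjointB (inner_u _)) subrK.
  apply: le_lt_trans (sq_le_double _ _) _; rewrite sq_remainder.
  have : 0 <= bsum F (y - z).
    by rewrite /bsum partial_sumE sumr_ge0// => s _; exact: sq_ge0.
  have {}yz : sq (y - z) < d / 4 := yz.
  by move: yz zF; lra.
move=> xE e0; apply: (xE (ClosedSubspace Llin Lclo)) e0.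
move=> _ [s _ <-] y Ky d d0; exists [fset s]%fset.
by rewrite sq_remainder /bsum partial_sumE big_seq_fset1 orth_proj_id// subrr.
Qed.

Lemma bessel_approx x e : cs_set (closed_span (range K)) x -> 0 < e ->
  exists F, sq x - e < partial_sum (fun s => sq (orth_proj (K s) x)) F.
Proof.
move=> xE /(span_approx xE)[F]; rewrite -/(u F x) sq_remainder => xF.
by exists F; rewrite ltrBlDr addrC -ltrBlDr.
Qed.

Lemma sub_closed_span s x : cs_set (K s) x -> cs_set (closed_span (range K)) x.
Proof. by move=> Kx L KL; apply: KL Kx; exists s. Qed.

(** This reduces to x in the span, because x and its projection onto the span have
the same projection onto every K s. *)
Lemma span_proj_approx x e : 0 < e -> exists F0, forall F, (F0 `<=` F)%fset ->
  sq (orth_proj (closed_span (range K)) x - \sum_(s <- F) orth_proj (K s) x) < e.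
Proof.
set y := orth_proj _ x; have yE : cs_set (closed_span (range K)) y.
  exact: orth_proj_in.
move=> /(span_approx yE)[F0 yF0]; exists F0 => F F0F.
rewrite (_ : \sum_(s <- F) _ = u F y); last first.
  apply: eq_bigr => s _; apply: orth_proj_unique; first exact: orth_proj_in.
  move=> z Kz; rewrite (_ : x - _ = (x - y) + (y - orth_proj (K s) y)).
    rewrite linearDl/= orth_projP// addr0.
    by apply: orth_projP; exact: sub_closed_span Kz.
  by rewrite addrA subrK.
by apply: le_lt_trans yF0; rewrite !sq_remainder lerD2l lerN2 S_mono.
Qed.

End orthogonal_family.

(** * The decomposition along an ideal *)

Section decomposition.
Context {R : realType} {N : nat}.
Implicit Types A B X T : op_tuple R N.

Lemma red_closed_span T (S : choiceType) (K : S -> closed_subspace (op_space T)) :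
  CDD T ->
  (forall s t, s <> t ->
    forall x y, cs_set (K s) x -> cs_set (K t) y -> inner x y = 0) ->
  (forall s, red T (K s)) -> red T (closed_span (range K)).
Proof.
move=> CT K_orth TK j x Tx; have [Tlin Tclo _] := CT j.
apply: (closed_op_graphP (T j)).1 => // e e0.
have [F xF] := span_proj_approx K_orth x e0.
have [G TxG] := span_proj_approx K_orth (app (T j) x) e0.
exists (\sum_(s <- (F `|` G)%fset) orth_proj (K s) x).
have [Ts Es] := linear_op_sum (F `|` G)%fset Tlin (fun s => (TK s j _ Tx).1).
split=> //; first by apply: xF; exact: fsubsetUl.
rewrite Es (eq_bigr (fun s => orth_proj (K s) (app (T j) x))); last first.
  by move=> s _; case: (TK s j _ Tx).
by apply: TxG; exact: fsubsetUr.
Qed.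

Variables (calA : op_tuple R N -> Prop) (hI : ideal calA).
Variables (T : op_tuple R N) (CT : CDD T).

Let good : set (closed_subspace (op_space T)) :=
  [set K | red T K /\ calA (restr T K)].

(** [ideal_isometric_family] for operators on the whole space that need be
isometric on W only: the components are C s followed by the projection onto
K s. *)
Lemma restr_isometric_family (S : choiceType) (W : closed_subspace (op_space T))
    (K : S -> closed_subspace (op_space T)) (C : S -> op_space T -> op_space T) :
  inhabited S -> red T W -> (forall s, good (K s)) ->
  (forall s, exists Cs, @adj_intertwiner R N T T (C s) Cs) ->
  (forall x F, cs_set W x ->
    partial_sum (fun s => sq (orth_proj (K s) (C s x))) F <= sq x) ->
  (forall x e, cs_set W x -> 0 < e -> exists F,
    sq x - e < partial_sum (fun s => sq (orth_proj (K s) (C s x))) F) ->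
  good W.
Proof.
move=> S0 TW FK CI Cle Capprox; split=> //.
pose Cs s := projT1 (cid (CI s)).
have CsI s : @adj_intertwiner R N T T (C s) (Cs s) by exact: projT2 (cid (CI s)).
apply: (@ideal_isometric_family R N calA hI (restr T W) _ S (fun s => restr T (K s))
  (fun s => sub_proj (K s) \o (C s \o @sub_val R _ W))
  (fun s => (sub_proj W \o Cs s) \o @sub_val R _ (K s))).
- exact: CDD_restr.
- move=> s; apply: adj_intertwiner_comp.
    by apply: adj_intertwiner_comp (CsI s); exact: sub_val_intertwiner.
  by apply: adj_intertwiner_sym; apply: sub_val_intertwiner; case: (FK s).
- by move=> x F; exact: (Cle (sub_val x) F (sub_valP x)).
- by move=> x e; exact: (Capprox (sub_val x) e (sub_valP x)).
- exact: S0.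
- by move=> s; case: (FK s).
Qed.

Lemma peel_intertwiner E K n : red T E -> red T K ->
  exists Ps, @adj_intertwiner R N T T (peel E K n) Ps.
Proof.
move=> TE TK; elim: n => [|n [Ps IH]]; first by exists id; split=> // j x.
exists (Ps \o orth_proj (orthocomplement (if odd n then E else K))).
apply: (adj_intertwiner_comp IH); apply: red_intertwiner.
by apply: red_compl => //; case: ifP.
Qed.

(** The part of the complement of E at a nontrivial angle with the complement of
K, that is, the closure of the projection of K onto the complement of E. *)
Let angle_part (E K : closed_subspace (op_space T)) := cs_inter (orthocomplement E)
  (orthocomplement (cs_inter (orthocomplement E) (orthocomplement K))).

(** Peeling is isometric on this part. It replaces the isometric factor of a polar
decomposition, at the price of mapping into infinitely many copies. *)
Lemma good_angle_part E K : good E -> good K -> good (angle_part E K).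
Proof.
move=> [TE AE] [TK AK].
have TE' := red_compl CT TE; have TK' := red_compl CT TK.
have TW : red T (angle_part E K).
  by apply: red_inter => //; apply: red_compl => //; exact: red_inter.
apply: (@restr_isometric_family nat (angle_part E K)
  (fun n => if odd n then E else K) (peel E K)) => //.
- by move=> n; case: ifP.
- by move=> n; exact: peel_intertwiner.
- by move=> x F _; exact: peel_partial_sum_le.
- by move=> x e [Ex x_perp] e0; apply: peel_cvg.
Qed.

(** The angle part of E and K is good and lies in the complement of E, so
disjointness makes it 0; then the complement of E is its own intersection with
the complement of K. *)
Lemma good_le E K : good E -> disjoint_class calA (restr T (orthocomplement E)) ->
  good K -> cs_set K `<=` cs_set E.
Proof.
move=> FE [_ disj] FK; have [TW AW] := good_angle_part FE FK.
have [TE AE] := FE; have [TK AK] := FK.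
set W := angle_part E K in TW AW.
have W0 w : cs_set W w -> w = 0.
  move=> Ww; apply: contrapT => w0; apply: (disj _ AW).
  exists (restr T W); split.
  - exact: CDD_restr.
  - move=> /(_ (sub_proj W w)) /(congr1 (@sub_val R _ W)).
    by rewrite /= orth_proj_id.
  - have VI := adj_intertwiner_comp (sub_val_intertwiner TW)
      (adj_intertwiner_sym (sub_val_intertwiner (red_compl CT TE))).
    have [|E' [_ ? ?]] := isometry_range VI; last by exists E'.
    move=> x; apply: val_inj => /=.
    by rewrite (orth_proj_id (sub_valP x).1) orth_proj_id//; exact: sub_valP.
  - have idI : @adj_intertwiner R N (restr T W) (restr T W) id id by split=> // j x.
    by have [|E' [_ ? ?]] := isometry_range idI; last by exists E'.
rewrite -(orthocomplementK E) => x Kx y Ey.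
set M := cs_inter (orthocomplement E) (orthocomplement K).
have yP : y - orth_proj M y = 0.
  apply: W0; split; last by move=> z /= Mz; exact: orth_projP.
  by apply: csB => //; case: (orth_proj_in M y).
move/eqP : yP; rewrite subr_eq0 => /eqP ->.
by apply: inner_eq0C; have [_] := orth_proj_in M y; exact.
Qed.

Lemma ideal_le X A : CDD X -> calA A -> tuple_le X A -> calA X.
Proof.
move=> CX AA [G AG XG].
apply: (ideal_equivalent hI) CX (unitarily_equivalent_sym XG).
exact: (ideal_restrict hI).
Qed.

(** The zero subspace keeps the maximal family below nonempty, as direct sums in
an ideal require an inhabited index type. An ideal contains the trivial tuples
because it is nonempty: on a trivial tuple, the zero map into any member is an
isometry. *)
Lemma good_zero : exists2 Z, good Z & forall x, cs_set Z x -> x = 0.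
Proof.
pose Z : closed_subspace (op_space T) := closed_span set0.
have Z0 x : cs_set Z x -> x = 0.
  move=> Zx; have Zx' : cs_set (orthocomplement Z) x by apply: Zx.
  by apply: sq_eq0; have := Zx' x Zx; rewrite innerxx => -[].
have PZ x : orth_proj Z x = 0 by apply: Z0; exact: orth_proj_in.
exists Z => //; have TZ : red T Z.
  move=> j x _; rewrite !PZ; have [[T0 Tlin] _ _] := CT j; split=> //.
  have [_] := Tlin (-1) _ _ T0 T0.
  by rewrite scaler0 addr0 scaleN1r addNr.
have val0 (x : subspace_type Z) : x = 0.
  by apply: val_inj; apply: Z0; exact: sub_valP.
split=> //; have [A AA] := ideal_nonempty hI.
have CA := ideal_CDD hI AA.
apply: (@ideal_isometric_family R N calA hI (restr T Z) _ unit (fun=> A)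
  (fun _ _ => 0) (fun _ _ => 0)) => //.
- exact: CDD_restr.
- move=> _; split=> [x y|j x _|j x _].
  + by rewrite linear0l linear0r.
  + have [[A0 Alin] _ _] := CA j; split=> //; have [_] := Alin (-1) _ _ A0 A0.
    by rewrite scaler0 addr0 scaleN1r addNr.
  + have [[T0 _] _ _] := CDD_restr CT TZ j; split=> //; exact: val0.
- by move=> x F; rewrite partial_sumE big1 ?sq_ge0// => s _; rewrite sq0.
- move=> x e e0; exists fset0; rewrite partial_sumE big_seq_fset0.
  by rewrite [x]val0 sq0 sub0r oppr_lt0.
Qed.

(** If disjointness failed for the span E of a maximal orthogonal family of good
subspaces, the common part would sit on a good subspace that extends the
family. *)
Lemma exists_decomposition : exists2 E, good E &
  disjoint_class calA (restr T (orthocomplement E)).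
Proof.
(* Only distinct members are required to be orthogonal, since no nonzero
   subspace is orthogonal to itself. *)
pose P (G : set (closed_subspace (op_space T))) := G `<=` good /\
  forall K L, G K -> G L -> K <> L ->
    forall x y, cs_set K x -> cs_set L y -> inner x y = 0.
have [|G [[GF G_orth] Gmax]] := @Zorn_bigcup _ P.
  move=> C CP Ctot; split=> [K [G CG GK]|K L [G1 CG1 G1K] [G2 CG2 G2L]].
    by have [GF _] := CP _ CG; exact: GF.
  have [G12|G21] := Ctot _ _ CG1 CG2.
    by have [_] := CP _ CG2; apply=> //; exact: G12.
  by have [_] := CP _ CG1; apply=> //; exact: G21.
(* Maximality: a good subspace orthogonal to the whole family is a member of it. *)
have G_add L : good L -> (forall K, G K -> forall x y, cs_set K x -> cs_set L y ->
    inner x y = 0) -> G L.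
  move=> FL GL; apply: contrapT => nGL; apply: (Gmax (G `|` [set L])).
    by split; [exact: subsetUl|move/(_ L)/(_ (or_intror erefl))].
  split=> [K [/GF|->]//|K K' [GK|->] [GK'|->] KK' x y Kx K'y //].
  - exact: (G_orth _ _ GK GK' KK').
  - exact: GL Kx K'y.
  - by apply: inner_eq0C; exact: GL K'y Kx.
have [Z FZ Z0] := good_zero.
have GZ : G Z by apply: G_add => // K _ x y _ /Z0 ->; exact: linear0r.
pose S : choiceType := {classic {K | G K}}.
pose K (s : S) : closed_subspace (op_space T) := sval (s : {K | G K}).
have K_orth s t : s <> t ->
    forall x y, cs_set (K s) x -> cs_set (K t) y -> inner x y = 0.
  move=> st; apply: G_orth; [exact: (svalP s)|exact: (svalP t)|].
  move=> Kst; apply: st; case: s t Kst => [k Gk] [l Gl] /= kl.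
  by subst l; congr exist; exact: Prop_irrelevance.
have KF s : good (K s) by apply: GF; exact: (svalP s).
pose E := closed_span (range K).
have TE : red T E by apply: red_closed_span => // s; case: (KF s).
have GE L : G L -> cs_set L `<=` cs_set E.
  by move=> GL x Lx; apply: (@sub_closed_span _ _ S K (exist _ L GL)).
exists E.
  apply: (@restr_isometric_family S E K (fun _ => id)) => //.
  - exact: inhabits (exist _ Z GZ).
  - by move=> s; exists id; split=> // j x.
  - by move=> x F _; exact: bessel.
  - by move=> x e Ex e0; exact: bessel_approx.
have TE' := red_compl CT TE.
split=> [|A AA [X [CX X0 [E' TE1 XE'] XA]]]; first exact: CDD_restr.
have AX := ideal_le CX AA XA.
have [J [Js [JI JK _]]] := (unitarily_equivalentP _ _).1 XE'.
have VI := adj_intertwiner_comp (adj_intertwiner_comp JI (sub_val_intertwiner TE1))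
  (sub_val_intertwiner TE').
have [|L [LV TL XL]] := isometry_range VI.
  by move=> x; rewrite /= !sub_projK JK.
have FL : good L.
  by split=> //; apply: (ideal_equivalent hI) AX _ XL; exact: CDD_restr.
have LE : cs_set L `<=` cs_set (orthocomplement E).
  by move=> _ /LV[x <-]; exact: sub_valP.
(* L is orthogonal to the family, hence a member, hence orthogonal to itself. *)
have GL : G L.
  apply: G_add => // K' GK' x y K'x Ly; apply: inner_eq0C.
  exact: LE Ly _ (GE _ GK' _ K'x).
apply: X0 => x.
have Lx : cs_set L (sub_val (sub_val (J x))) by apply/LV; exists x.
have /sq_eq0 Jx0 : sq (J x) = 0.
  have := LE _ Lx _ (GE _ GL _ Lx).
  by rewrite innerxx => -[].
have [Jsadj _ _] := adj_intertwiner_sym JI.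
by rewrite -[x]JK Jx0 -[0](subrr 0) (adjointB Jsadj) subrr.
Qed.

Lemma good_closed_span E : good E ->
  disjoint_class calA (restr T (orthocomplement E)) -> E = closed_span good.
Proof.
move=> FE disj; apply: closed_subspace_ext => x; split=> [Ex L|xF].
  by move=> FL; exact: FL FE _ Ex.
by apply: xF => K FK; exact: good_le.
Qed.

(** U is the reflection in K: x and U x add up to twice the projection of x. *)
Lemma good_invariant E K : good E -> (forall L, good L -> cs_set L `<=` cs_set E) ->
  red T K -> forall x, cs_set E x -> cs_set E (orth_proj K x).
Proof.
move=> [TE AE] maxE TK x Ex.
pose U y := orth_proj K y - orth_proj (orthocomplement K) y.
have UI : @adj_intertwiner R N T T U U.
  have K'I := red_intertwiner (red_compl CT TK); have KI := red_intertwiner TK.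
  have UT : @intertwines R N T T U.
    move=> j y Ty; have [[_ Tlin] _ _] := CT j.
    have [Ty1 E1] := TK j _ Ty; have [Ty2 E2] := red_compl CT TK Ty.
    have [] := Tlin (-1) _ _ Ty2 Ty1.
    by rewrite !scaleN1r ![- _ + _]addrC E1 E2.
  by split=> // y z; rewrite /U linearBl linearBr/= !orth_proj_sym.
have UU : cancel U U.
  move=> y; rewrite /U !orth_projC; set p := orth_proj K y.
  have Kp : cs_set K p by exact: orth_proj_in.
  have -> : orth_proj K (p - (y - p)) = p.
    by rewrite !orth_projB !(orth_proj_id Kp) subrr subr0.
  have -> : p - (y - p) - p = - (y - p) by rewrite addrAC subrr add0r.
  by rewrite opprK addrC subrK.
have VI := adj_intertwiner_comp (sub_val_intertwiner TE) UI.
have [|L [LV TL EL]] := isometry_range VI.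
  by move=> y; rewrite /= UU sub_projK.
have FL : good L.
  by split=> //; apply: (ideal_equivalent hI) AE _ EL; exact: CDD_restr.
have EU : cs_set E (U x).
  apply: (maxE _ FL); apply/LV; exists (sub_proj E x).
  by rewrite /= orth_proj_id.
rewrite -(scaler_half_double (orth_proj K x)); apply: csZ.
have -> : orth_proj K x + orth_proj K x = x + U x.
  by rewrite /U orth_projC opprB addrCA [x + _]addrC subrK.
exact: csD.
Qed.

End decomposition.

(** Invariance of E under a projection implies that of its complement. *)
Lemma invariant_commute (R : realType) (H : hilbertType R) (E K : closed_subspace H) :
  (forall x, cs_set E x -> cs_set E (orth_proj K x)) ->
  forall x, orth_proj E (orth_proj K x) = orth_proj K (orth_proj E x).
Proof.
move=> EK x; apply: orth_proj_unique => [|z Ez].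
  by apply: EK; exact: orth_proj_in.
by rewrite -orth_projB orth_proj_sym; apply: orth_projP; exact: EK.
Qed.

Theorem theorem5p1 (R : realType) (N : nat) (hN : (1 <= N)%N)
    (calA : op_tuple R N -> Prop) (hI : ideal calA)
    (T : op_tuple R N) (hT : CDD T) :
  exists E : closed_subspace (op_space T),
    [/\ unique (fun E' : closed_subspace (op_space T) =>
          [/\ red T E', calA (restr T E') &
              disjoint_class calA (restr T (orthocomplement E'))]) E,
        cred T E &
        E = closed_span [set K | red T K /\ calA (restr T K)]].
Proof.
have [E FE disj] := exists_decomposition hI hT.
have Espan := good_closed_span hI hT FE disj.
have [TE AE] := FE; exists E; split=> //.
- split=> [//|E' [TE' AE' disj']].
  by rewrite Espan [RHS](good_closed_span hI hT (conj TE' AE') disj').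
- split=> // K TK; apply: invariant_commute => x Ex.
  apply: (good_invariant hI hT FE) TK _ Ex => L FL.
  exact: (good_le hI hT FE disj FL).
Qed.
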